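(* Let $\mathcal O$ be an elliptic conjugacy class of $\tilde W$ and let $\tilde w\in\mathcal O_{\min}$ be an element of minimal length in $\mathcal O$. Then the map $$\tau_{\tilde w}:\mathcal P_{\tilde w,\tilde w}\to Z_W(\tilde w),\qquad (i_1,\dots,i_t)\mapsto s_{i_1}\cdots s_{i_t}$$ is surjective, where $Z_W(\tilde w)=\{w\in W:\ w\tilde w=\tilde w w\}$.
   Context: $(W,S)$ is a finite Coxeter group with simple reflections $s_i$ ($i\in S$) and length function $\ell$; $\delta:W\to W$ is a group automorphism permuting the simple reflections; $\tilde W=\langle\delta\rangle\ltimes W$, with $\ell(\delta^k w)=\ell(w)$ for $k\in\mathbb Z$, $w\in W$. $V$ is a finite-dimensional real inner product space with an injective homomorphism $\tilde W\to GL(V)$ preserving the inner product, such that each $s_i$ acts as a reflection. A Weyl chamber is a connected component of the complement in $V$ of all reflecting hyperplanes of reflections in $W$. The fundamental chamber $C$ is the Weyl chamber whose walls are the reflecting hyperplanes of the $s_i$, $i\in S$, and $\delta(C)=C$. $V^W$ is the space of $W$-fixed vectors. A conjugacy class $\mathcal O$ of $\tilde W$ is elliptic if for some (equivalently any) $\tilde w\in\mathcal O$ every vector of $V$ fixed by $\tilde w$ lies in $V^W$. $\mathcal O_{\min}$ is the set of elements of minimal length in $\mathcal O$. For $\tilde w$ of minimal length in its conjugacy class: $\mathcal P_{\tilde w,\tilde w}$ is the set of finite sequences $(i_1,\dots,i_t)$ ($t\ge 0$) of elements of $S$ such that $\tilde w\xrightarrow{s_{i_1}} s_{i_1}\tilde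 w s_{i_1}\xrightarrow{s_{i_2}}\cdots\xrightarrow{s_{i_t}} s_{i_t}\cdots s_{i_1}\tilde w s_{i_1}\cdots s_{i_t}$ and $s_{i_t}\cdots s_{i_1}\tilde w s_{i_1}\cdots s_{i_t}=\tilde w$, where $\tilde x\xrightarrow{s_i}\tilde x'$ means $\tilde x'=s_i\tilde x s_i$ and $\ell(\tilde x')\le\ell(\tilde x)$. *)

(* Defs.v *)
From HB Require Import structures.
From mathcomp Require Import all_boot all_order all_algebra all_fingroup.
From mathcomp Require Import sesquilinear.
From mathcomp Require Import boolp classical_sets functions reals topology.
From mathcomp Require Import normedtype.

Set Implicit Arguments.
Unset Strict Implicit.
Unset Printing Implicit Defensive.

Import Order.TTheory GRing.Theory Num.Theory.
Import numFieldNormedType.Exports.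

Local Open Scope ring_scope.

(* A Euclidean space is a [V : normedVectType R] together with a form
   [dot : {dot V for idfun}] such that [dot v v = `|v| ^+ 2]. *)
#[short(type="normedVectType")]
HB.structure Definition NormedVector (R : numFieldType) :=
  {V of NormedModule R V & Vector R V}.

Section CoxeterGroup.
Local Open Scope group_scope.
Variables (W : finGroupType) (S : finType) (s : S -> W).

(* The entry 0 encodes the value infinity: then [x ^+ 0 = 1] is no relation. *)
Definition coxeter_matrix (m : S -> S -> nat) : Prop :=
  [/\ forall i, m i i = 1%N,
      forall i j, m i j = m j i
    & forall i j, i != j -> m i j <> 1%N].

(* [s] presents [W] as < S | (s_i s_j) ^ m_ij = 1 >; the presentation is
   expressed by its universal property, among all groups, finite or not. *)
Definition coxeter_system : Prop :=
  exists2 m, coxeter_matrix m &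
  [/\ <<[set s i | i : S]>> = [set: W],
      forall i j, (s i * s j) ^+ m i j = 1
    & forall (G : groupType) (f : S -> G),
        (forall i j, (f i * f j) ^+ m i j = 1) ->
        exists phi : {multiplicative W -> G}, forall i, phi (s i) = f i].

Definition word_prod (p : seq S) : W := \prod_(i <- p) s i.

Definition has_word (w : W) (n : nat) : bool :=
  [exists t : n.-tuple S, word_prod t == w].

(* The default value is irrelevant as soon as [s] generates [W]. *)
Definition cox_length (w : W) : nat :=
  if pselect (exists n, has_word w n) is left ex then ex_minn ex else 0%N.

End CoxeterGroup.

Section TwistedGroup.
Local Open Scope group_scope.
Variables (W : finGroupType) (S : finType) (s : S -> W).
Variables (delta : {perm W}) (autd : delta \in Aut [set: W]).

Lemma cycle_sub_Aut : <[delta]> \subset Aut [set: W].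
Proof. by rewrite cycle_subG. Qed.

(* <delta> |>< W, where <delta> is the cyclic subgroup of Aut W. *)
Definition twisted : finGroupType :=
  sdprod_groupType (aut_groupAction [set: W] \ cycle_sub_Aut)%gact.

Definition tw_in (w : W) : twisted :=
  sdpair1 (aut_groupAction [set: W] \ cycle_sub_Aut)%gact w.

(* MathComp actions are right actions, whence the inverse: see [tw_deltaJ]. *)
Definition tw_delta : twisted :=
  sdpair2 (aut_groupAction [set: W] \ cycle_sub_Aut)%gact delta^-1.

Lemma tw_deltaJ w : tw_delta * tw_in w * tw_delta^-1 = tw_in (delta w).
Proof.
have Dd : delta \in <[delta]> by rewrite cycle_id.
rewrite /tw_delta /tw_in morphV ?invgK //.
have := @sdpair_act _ _ _ _ (aut_groupAction [set: W] \ cycle_sub_Aut)%gact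
  w delta (finset.in_setT _) Dd.
by rewrite conjgE mulgA => <-.
Qed.

(* An element of [twisted] is a pair (a, w), which denotes the product a w. *)
Definition tw_length (x : twisted) : nat := cox_length s x.2.

Definition class_min (O : {set twisted}) : {set twisted} :=
  [set x in O | [forall y in O, (tw_length x <= tw_length y)%N]].

(* [p] is the sequence of labels of a path from [x] to [y] along which the
   length never increases. *)
Fixpoint conj_path (x : twisted) (p : seq S) (y : twisted) : bool :=
  if p is i :: p' then
    let x' := tw_in (s i) * x * tw_in (s i) in
    (tw_length x' <= tw_length x)%N && conj_path x' p' y
  else x == y.

Definition loops (x : twisted) : set (seq S) :=
  [set p : seq S | conj_path x p x]%classic.

Definition centW (x : twisted) : set W :=
  [set w : W | tw_in w * x = x * tw_in w]%classic.

Section Geometry.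
Local Open Scope ring_scope.
Local Open Scope classical_set_scope.
Variables (R : realType) (V : normedVectType R) (dot : {dot V for idfun}).
Variable rho : twisted -> 'End(V).

Definition orth_faithful_rep : Prop :=
  [/\ rho 1%g = \1%VF,
      forall x y, rho (x * y)%g = (rho x \o rho y)%VF,
      injective rho
    & forall x u v, dot (rho x u) (rho x v) = dot u v].

Definition is_reflection (f : V -> V) : Prop :=
  exists2 a : V, a != 0 &
    forall v, f v = v - (2 * dot v a / dot a a) *: a.

Definition fixed_by (x : twisted) : set V := [set v | rho x v = v].

Definition refl_hyperplanes : set (set V) :=
  [set fixed_by (tw_in w) | w in [set w | is_reflection (rho (tw_in w))]].

Definition regular : set V := ~` \bigcup_(H in refl_hyperplanes) H.

Definition weyl_chamber (C : set V) : Prop :=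
  exists2 v, regular v & C = connected_component regular v.

(* A reflecting hyperplane is a wall of C when it meets the closure of C in a
   set with nonempty interior relative to the hyperplane. *)
Definition walls (C : set V) : set (set V) :=
  [set H | refl_hyperplanes H /\
    exists2 v, H v & \forall u \near v, H u -> closure C u].

Definition fundamental_chamber (C : set V) : Prop :=
  [/\ weyl_chamber C,
      walls C = [set fixed_by (tw_in (s i)) | i in [set: S]]
    & rho tw_delta @` C = C].

Definition fixedW : set V := \bigcap_(w in [set: W]) fixed_by (tw_in w).

Definition elliptic (O : {set twisted}) : Prop :=
  exists2 x, x \in O & fixed_by x `<=` fixedW.

End Geometry.
End TwistedGroup.

(* Main.v *)
Require Import Defs.
From HB Require Import structures.
From mathcomp Require Import all_boot all_order all_algebra all_fingroup.
From mathcomp Require Import sesquilinear.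
From mathcomp Require Import boolp classical_sets functions reals topology.
From mathcomp Require Import normedtype.
From mathcomp Require Import cardinality derive ring lra.

(** The [w]-displacement of a chamber is the number of hyperplanes separating it from
    its image under an isometry [w]: for the chamber [y C] of a Coxeter group
    it is the length of [y^-1 w y].  Hence the loops of the statement are the
    galleries from [C] to [z C] along which the displacement never increases,
    and the corollary is an instance of a fact about any finite central
    arrangement preserved by an isometry [w] whose fixed vectors lie on every
    hyperplane: each chamber is joined by such a gallery to each chamber of
    minimal displacement.

    Let [g = w + w^-1].  Crossing [a^perp] at a point [h] on no other
    hyperplane, towards the side of [a], changes the displacement by
    [- sgn <h, w a> - sgn <h, w^-1 a>], which is at most [0] when
    [<g h, a> > 0]; and when [h] is an eigenvector of [g] only the hyperplanes
    containing both [h] and [w h] contribute a change.  Maximising the Rayleigh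
    quotient of [g] over the closures of the reachable chambers therefore
    leads, by induction on the arrangement, to a chamber whose closure contains
    a generic point of the top eigenspace [U] of [g].  Along a generic segment
    of [U] the displacement is constant, so two such chambers are compared by
    induction on the arrangement of the hyperplanes containing [U]. *)

Set Implicit Arguments.
Unset Strict Implicit.
Unset Printing Implicit Defensive.

Import Order.TTheory GRing.Theory Num.Theory.
Import numFieldNormedType.Exports.

Local Open Scope ring_scope.

(** * Inner products and the Rayleigh quotient *)

Section InnerProduct.
Variables (R : realType) (V : vectType R) (dot : {dot V for idfun}).
Implicit Types (u v x p z : V) (c : R).

Lemma dotC u v : dot u v = dot v u.
Proof. by rewrite hermC expr0 mul1r. Qed.

Lemma dotDl u v x : dot (u + v) x = dot u x + dot v x.
Proof. exact: linearDl. Qed.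

Lemma dotZl c u x : dot (c *: u) x = c * dot u x.
Proof. exact: linearZl_LR. Qed.

Lemma dotNl u x : dot (- u) x = - dot u x.
Proof. exact: linearNl. Qed.

Lemma dot0l x : dot 0 x = 0.
Proof. exact: linear0l. Qed.

Lemma dotDr x u v : dot x (u + v) = dot x u + dot x v.
Proof. by rewrite !(dotC x) dotDl. Qed.

Lemma dotZr c x u : dot x (c *: u) = c * dot x u.
Proof. by rewrite !(dotC x) dotZl. Qed.

Lemma dotNr x u : dot x (- u) = - dot x u.
Proof. by rewrite !(dotC x) dotNl. Qed.

Lemma dot_suml (I : Type) (r : seq I) (F : I -> V) x :
  dot (\sum_(i <- r) F i) x = \sum_(i <- r) dot (F i) x.
Proof. exact: linear_sumlz. Qed.

Definition dotE := (dotDl, dotZl, dotNl, dotDr, dotZr, dotNr).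

Lemma dot_gt0 u : u != 0 -> 0 < dot u u.
Proof. exact: neq0_dnorm_gt0. Qed.

Lemma dot_ge0 u : 0 <= dot u u.
Proof. by have [->|/dot_gt0/ltW//] := eqVneq u 0; rewrite dot0l. Qed.

Lemma dot_eq0 u : dot u u <= 0 -> u = 0.
Proof. by apply: contraTeq => /dot_gt0; rewrite -ltNge. Qed.

Lemma span_orth (X : seq V) u : (forall x, x \in X -> dot u x = 0) ->
  forall y, y \in <<X>>%VS -> dot u y = 0.
Proof.
move=> uX y /(@coord_span _ _ _ (in_tuple X)) ->.
rewrite dotC dot_suml big1 // => i _.
by rewrite dotZl dotC uX ?mulr0// memt_nth.
Qed.

Lemma projection (X : seq V) v :
  exists2 v1, v1 \in <<X>>%VS & forall x, x \in X -> dot (v - v1) x = 0.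
Proof.
elim: X v => [|x X IH] v; first by exists 0; rewrite ?mem0v.
have subX : {subset <<X>>%VS <= <<x :: X>>%VS}.
  by apply/subvP; rewrite span_cons addvSr.
have [x1 x1X x2X] := IH x; have [v1 v1X v2X] := IH v.
pose x2 := x - x1; pose c := dot (v - v1) x2 / dot x2 x2.
exists (v1 + c *: x2) => [|y].
  apply: memvD; first exact: subX.
  by apply/memvZ/memvB; [rewrite memv_span ?mem_head | exact: subX].
rewrite inE opprD addrA [dot (_ - _ - _) _]dotDl dotNl dotZl =>
  /predU1P[->{y}|yX]; last first.
  by rewrite v2X // x2X // mulr0 subrr.
have -> : dot x2 x = dot x2 x2.
  by rewrite -[X in dot _ X = _](subrK x1) dotDr (span_orth x2X x1X) ?addr0.
have -> : dot (v - v1) x = dot (v - v1) x2.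
  by rewrite -[X in dot _ X = _](subrK x1) dotDr (span_orth v2X x1X) ?addr0.
have [->|/dot_gt0 n0] := eqVneq x2 0; first by rewrite dotC !dot0l mulr0 subrr.
by rewrite /c divfK ?subrr ?gt_eqF.
Qed.

Lemma perturb (s : seq V) p z : exists2 e0 : R, 0 < e0 &
  forall e, 0 < e <= e0 -> forall x, x \in s ->
  Num.sg (dot (p + e *: z) x) =
    if dot p x == 0 then Num.sg (dot z x) else Num.sg (dot p x).
Proof.
elim: s => [|x s [e0 e0gt0 IH]]; first by exists 1.
have [px0|px0] := eqVneq (dot p x) 0.
  exists e0 => // e ee0 y; rewrite inE => /predU1P[->|]; last exact: IH.
  case/andP: ee0 => e_gt0 _.
  by rewrite px0 eqxx dotDl px0 add0r dotZl sgrM gtr0_sg ?mul1r.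
pose e1 := `|dot p x| / (`|dot z x| + 1) / 2.
have z1 : 0 < `|dot z x| + 1 by rewrite ltr_wpDl.
have p1 : 0 < `|dot p x| by rewrite normr_gt0.
have e1gt0 : 0 < e1 by rewrite !divr_gt0.
exists (Num.min e0 e1) => [|e /andP[e_gt0]]; first by rewrite lt_min e0gt0.
rewrite le_min => /andP[ee0 ee1] y; rewrite inE => /predU1P[->{y}|]; last first.
  by apply: IH; rewrite e_gt0.
rewrite (negPf px0) dotDl dotZl.
have : `|e * dot z x| < `|dot p x|.
  rewrite normrM (gtr0_norm e_gt0).
  have : e * (`|dot z x| + 1) <= `|dot p x| / 2.
    by rewrite -ler_pdivlMr// mulrAC.
  have : 0 <= `|dot z x| by [].
  by move: e_gt0 p1; nra.
rewrite ltr_norml => /andP[].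
case/lt_total/orP: px0 => sg.
  rewrite (ltr0_norm sg) => h1 h2; rewrite !ltr0_sg//; lra.
by rewrite (gtr0_norm sg) => h1 h2; rewrite !gtr0_sg//; lra.
Qed.

Lemma generic_vector (U : {vspace V}) (s : seq V) : exists2 z, z \in U &
  forall x, x \in s -> (exists2 u, u \in U & dot u x != 0) -> dot z x != 0.
Proof.
elim: s => [|x s [z zU IH]]; first by exists 0; rewrite ?mem0v.
have [[zx0 [u uU ux]]|nzx] :=
    pselect (dot z x == 0 /\ exists2 u, u \in U & dot u x != 0); last first.
  exists z => // y; rewrite inE => /predU1P[-> ux|]; last exact: IH.
  by apply: contra_notN nzx.
have [e e_gt0 /(_ e)] := perturb (x :: s) z u.
rewrite e_gt0 lexx => /(_ isT) eP.
exists (z + e *: u); first by rewrite memvD ?memvZ.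
move=> y ys uy; rewrite -sgr_eq0 eP//.
case: ifP => [zy0|/negbT]; rewrite ?sgr_eq0//.
move: ys; rewrite inE => /predU1P[->//|ys].
by have := IH _ ys uy; rewrite zy0.
Qed.

Lemma critical_point (g : 'End(V)) (symg : forall u v, dot (g u) v = dot u (g
  v))
    (h : V) c (hc : dot (g h) h = c * dot h h) :
  let u := g h - c *: h in u != 0 -> exists2 t0 : R, 0 < t0 &
  forall t, 0 < t <= t0 ->
    c * dot (h + t *: u) (h + t *: u) < dot (g (h + t *: u)) (h + t *: u).
Proof.
move=> u u0.
have uh : dot u h = 0 by rewrite /u dotDl dotNl dotZl hc subrr.
have ghu : dot (g h) u = dot u u.
  by rewrite -[g h](subrK (c *: h)) -/u dotDl dotZl (dotC h) uh mulr0 addr0.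
have uu := dot_gt0 u0; clearbody u.
pose K : R := `|c * dot u u - dot (g u) u|.
have K0 : 0 < K + 1 by rewrite ltr_wpDl ?normr_ge0.
exists (dot u u / (K + 1)) => [|t /andP[t0]]; first by rewrite divr_gt0.
rewrite ler_pdivlMr // => tK.
have -> : g (h + t *: u) = g h + t *: g u by rewrite linearD linearZ.
rewrite !dotE hc (dotC h u) uh (symg u h) (dotC u (g h)) ghu.
have : c * dot u u - dot (g u) u <= K by rewrite /K ler_norm.
move: tK; set k := dot (g u) u; set a := dot u u; move=> tK Kk.
have : t * K < 2 * a by nra.
move=> h1.
have h2 : t * (t * K) < t * (2 * a) by rewrite ltr_pM2l.
have h3 : t * t * (c * a - k) <= t * t * K.
  by rewrite ler_wpM2l // mulr_ge0 // ltW.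
nra.
Qed.

End InnerProduct.

Section RayleighQuotient.
Local Open Scope classical_set_scope.
Variables (R : realType) (V : vectType R) (dot : {dot V for idfun}).

Lemma linear_form_continuous n (c : 'I_n -> R) :
  continuous (fun x : 'rV[R]_n => \sum_i x 0 i * c i).
Proof.
move=> x; apply: continuous_big => //=; first exact: add_continuous.
move=> i _ y; apply: (@continuousM _ _ (fun x : 'rV[R]_n => x 0 i)).
  exact: coord_continuous.
exact: cst_continuous.
Qed.

Lemma rayleigh_max (g : 'End(V)) (U : {vspace V}) (T : finType) (Q : pred T)
    (s : T -> seq V) (K := fun v => v \in U /\
      exists2 i, Q i & forall x, x \in s i -> 0 <= dot v x) :
  (exists2 v, K v & v != 0) ->
  exists2 h, K h /\ h != 0 &
    forall v, K v -> dot (g v) v * dot h h <= dot (g h) h * dot v v.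
Proof.
move=> [v0 Kv0 v0n0].
pose n := \dim U; pose e := vbasis U.
pose lin (x : 'rV[R]_n) : V := \sum_i x 0 i *: e`_i.
have linU x : lin x \in U.
  by apply: memv_suml => i _; rewrite memvZ// vbasis_mem ?memt_nth.
have lin_surj v : v \in U -> exists x, v = lin x.
  move=> vU; exists (\row_i coord e i v); rewrite {1}(coord_vbasis vU).
  by apply: eq_bigr => i _; rewrite mxE.
have lin0 x : lin x = 0 -> x = 0.
  move=> /(congr1 (fun v => coord e ^~ v)) x0; apply/rowP => i; rewrite mxE.
  have := congr1 (fun f => f i) x0.
  by rewrite /lin coord_sum_free ?(basis_free (vbasisP U))// linear0.
have linZ c x : lin (c *: x) = c *: lin x.
  by rewrite /lin scaler_sumr; apply: eq_bigr => i _; rewrite mxE scalerA.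
have dotlin v : continuous (fun x => dot (lin x) v).
  have -> : (fun x => dot (lin x) v) =
      fun x : 'rV[R]_n => \sum_i x 0 i * dot e`_i v.
    apply/funext => y; rewrite /lin dot_suml; apply: eq_bigr => i _.
    by rewrite dotZl.
  exact: linear_form_continuous.
have cont2 (f : 'End(V)) : continuous (fun x => dot (f (lin x)) (lin x)).
  have -> : (fun x => dot (f (lin x)) (lin x)) =
      fun x : 'rV[R]_n => \sum_i x 0 i * dot (lin x) (f e`_i).
    apply/funext => y; have -> : f (lin y) = \sum_i y 0 i *: f e`_i.
      by rewrite linear_sum; apply: eq_bigr => i _; rewrite linearZ.
    by rewrite dot_suml; apply: eq_bigr => i _; rewrite dotZl dotC.
  move=> x; apply: continuous_big => //=; first exact: add_continuous.
  move=> i _ y; apply: (@continuousM _ _ (fun x : 'rV[R]_n => x 0 i)).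
    exact: coord_continuous.
  exact: dotlin.
have KZ c v : 0 < c -> K v -> K (c *: v).
  move=> c0 [vU [i Qi vi]]; split; first by rewrite memvZ.
  by exists i => // y ys; rewrite dotZl pmulr_rge0 ?vi.
pose A := [set x : 'rV[R]_n | `|x| = 1 /\ K (lin x)].
have normalise v : K v -> v != 0 -> exists2 x, A x &
    exists2 c, 0 < c & v = c *: lin x.
  move=> Kv vn0; have [x vx] := lin_surj v Kv.1.
  have x0 : x != 0.
    apply: contraNneq vn0 => x0; rewrite vx x0.
    by rewrite -(scale0r (0 : 'rV[R]_n)) linZ scale0r.
  have nx : 0 < `|x| by rewrite normr_gt0.
  exists (`|x|^-1 *: x); last first.
    by exists `|x| => //; rewrite linZ scalerA divff ?gt_eqF// scale1r.
  split; last by rewrite linZ -vx; apply: KZ; rewrite ?invr_gt0.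
  by rewrite normrZ normfV normr_id mulVf ?gt_eqF.
have Anz x : A x -> 0 < dot (lin x) (lin x).
  move=> [nx _]; apply: dot_gt0; apply/eqP => /lin0 x0.
  by move: nx; rewrite x0 normr0 => /esym/eqP; rewrite oner_eq0.
have A0 : A !=set0 by have [x Ax _] := normalise _ Kv0 v0n0; exists x.
have Acl : closed A.
  rewrite [A](_ : _ = [set x | `|x| = 1] `&`
    \bigcup_(i in [set i | Q i])
      \bigcap_(y in [set y | y \in s i]) [set x | 0 <= dot (lin x) y]).
    apply: closedI.
      apply: (@closed_comp _ _ (fun x : 'rV[R]_n => `|x|) [set 1]).
        by move=> x _; exact: norm_continuous.
      exact: closed_eq.
    apply: closed_bigcup; first exact: finite_finset.
    move=> i _; apply: closed_bigI => y _.
    apply: (@closed_comp _ _ (fun x => dot (lin x) y) [set x | 0 <= x]).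
      by move=> x _; exact: dotlin.
    exact: closed_ge.
  apply/seteqP; split => [x [nx [_ [i Qi xi]]]|x [nx [i Qi xi]]].
    by split => //; exists i => // y; exact: xi.
  by split => //; split => //; exists i.
have Aco : compact A.
  apply: bounded_closed_compact => //.
  exists 1; split; first exact: real1.
  by move=> M M1 x [/= -> _]; exact: ltW.
pose F x := dot (g (lin x)) (lin x) / dot (lin x) (lin x).
have [] := @compact_EVT_max _ _ F A A0 Aco.
  rewrite continuous_subspace_in => x; rewrite inE => Ax.
  apply: continuous_subspaceT_for => //.
  apply: (@continuousM _ _ (fun x => dot (g (lin x)) (lin x))).
    exact: cont2.
  apply: (@continuousV _ _ (fun x => dot (lin x) (lin x))).
    by rewrite gt_eqF ?Anz.
  have := @cont2 \1%VF x; under eq_fun do rewrite id_lfunE; exact.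
move=> x; rewrite inE => Ax Fmax; exists (lin x).
  split; first by case: Ax.
  by apply: contraTneq (Anz _ Ax) => ->; rewrite dot0l ltxx.
move=> v Kv; have [->|vn0] := eqVneq v 0.
  by rewrite linear0 !dot0l mulr0 mul0r.
have [y Ay [c c0 ->]] := normalise _ Kv vn0.
have /Fmax : y \in A by rewrite inE.
rewrite /F ler_pdivrMr ?Anz// mulrAC ler_pdivlMr ?Anz// => le.
have -> : g (c *: lin y) = c *: g (lin y) by rewrite linearZ.
rewrite !dotE -!mulrA !(mulrCA _ c).
by rewrite !ler_pM2l.
Qed.

End RayleighQuotient.

(** * Displacement of the chambers of an arrangement *)

Section Arrangement.
Import mathcomp.boot.fintype mathcomp.boot.finset.
Variables (R : realType) (V : vectType R) (dot : {dot V for idfun}).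
Variables (w w' : 'End(V)).
Hypothesis w_adj : forall u v, dot (w u) v = dot u (w' v).
Hypotheses (wK : cancel w w') (w'K : cancel w' w).
Variables (I : finType) (r : I -> V) (neg : I -> I) (sigma : {perm I}).
Hypothesis r_neg : forall i, r (neg i) = - r i.
Hypothesis r_sigma : forall i, r (sigma i) = w (r i).
Hypothesis r_unit : forall i, dot (r i) (r i) = 1.
Hypothesis r_line : forall i j c, r i = c *: r j -> i = j \/ i = neg j.
Implicit Types (i j a : I) (p q u v h z : V) (A B P Q : {set I}) (c e : R).

Lemma r_neq0 i : r i != 0.
Proof.
by apply: contra_eq_neq (r_unit i) => ->; rewrite dot0l eq_sym oner_eq0.
Qed.

Lemma neg_neq i : neg i != i.
Proof.
apply/eqP => ni; have := dotNr dot (r i) (r i).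
by rewrite -r_neg ni r_unit => /eqP; rewrite -addr_eq0 (pnatr_eq0 _ 2).
Qed.

Lemma r_inj : injective r.
Proof.
move=> i j rij; have [//|ij] : i = j \/ i = neg j.
  by apply: (r_line (c := 1)); rewrite scale1r.
have := dotNr dot (r j) (r j).
by rewrite -r_neg -ij rij r_unit => /eqP; rewrite -addr_eq0 (pnatr_eq0 _ 2).
Qed.

Lemma negK : involutive neg.
Proof. by move=> i; apply: r_inj; rewrite !r_neg opprK. Qed.

Lemma sigma_neg i : sigma (neg i) = neg (sigma i).
Proof. by apply: r_inj; rewrite r_neg !r_sigma r_neg linearN. Qed.

Lemma r_sigmaV i : r ((sigma^-1)%g i) = w' (r i).
Proof. by rewrite -{2}(permKV sigma i) r_sigma wK. Qed.

Let d v i := dot v (r i).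

Lemma d_neg v i : d v (neg i) = - d v i.
Proof. by rewrite /d r_neg dotNr. Qed.

Lemma dD u v i : d (u + v) i = d u i + d v i.
Proof. exact: dotDl. Qed.

Lemma dZ c v i : d (c *: v) i = c * d v i.
Proof. exact: dotZl. Qed.

Definition add_inverse : 'End(V) := (w + w')%VF.
Local Notation g := add_inverse.

Lemma gE v : g v = w v + w' v.
Proof. by rewrite add_lfunE. Qed.

Lemma w'_adj u v : dot (w' u) v = dot u (w v).
Proof. by rewrite dotC -w_adj dotC. Qed.

Lemma g_sym u v : dot (g u) v = dot u (g v).
Proof. by rewrite !gE dotDl dotDr w_adj w'_adj addrC. Qed.

Lemma d_g v i : d (g v) i = d v (sigma i) + d v ((sigma^-1)%g i).
Proof. by rewrite /d gE dotDl w_adj w'_adj r_sigma r_sigmaV addrC. Qed.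

Definition stable B := forall i, i \in B -> neg i \in B /\ sigma i \in B.

Lemma stable_neg B i : stable B -> (neg i \in B) = (i \in B).
Proof.
by move=> sB; apply/idP/idP => /sB[]; rewrite ?negK.
Qed.

Lemma stable_sigma B i : stable B -> (sigma i \in B) = (i \in B).
Proof.
move=> sB; have im : (sigma @: B = B)%SET.
  apply/eqP; rewrite eqEcard card_imset ?leqnn ?andbT; last exact: perm_inj.
  by apply/subsetP => _ /imsetP[j /sB[_ ?] ->].
by rewrite -{1}im mem_imset //; exact: perm_inj.
Qed.

Lemma stable_sigmaV B i : stable B -> ((sigma^-1)%g i \in B) = (i \in B).
Proof. by move=> sB; rewrite -(stable_sigma _ sB) permKV. Qed.

Definition pos B v := [set i in B | 0 < d v i]%SET.
Definition regular_pt B v := forall i, i \in B -> d v i != 0.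

(* Each hyperplane separating the chamber from its image is counted once, as
   [P] contains exactly one of its two unit normals. *)
Definition disp P := #|[set i in P | sigma i \notin P]%SET|.
Definition flip a P := a |: (P :\ neg a).

Definition step B P Q := `[< exists p q a,
  [/\ regular_pt B p, regular_pt B q & P = pos B p] /\
  [/\ Q = pos B q, a \in Q, a \notin P, Q = flip a P & (disp Q <= disp P)%N] >].
Definition reach B := connect (step B).

(* [v] lies in the closure of the chamber of [p]. *)
Definition adherent B p v := forall i, i \in pos B p -> 0 <= d v i.

Lemma posP B v i : reflect (i \in B /\ 0 < d v i) (i \in pos B v).
Proof. by rewrite inE; apply: andP. Qed.

Lemma pos_neg B v i : stable B -> regular_pt B v -> i \in B ->
  (neg i \in pos B v) = (i \notin pos B v).
Proof.
move=> sB rv iB; rewrite !inE stable_neg // iB /= d_neg oppr_gt0.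
by rewrite -leNgt le_eqVlt (negPf (rv _ iB)).
Qed.

Lemma eq_pos B p q :
  (forall i, i \in B -> Num.sg (d p i) = Num.sg (d q i)) -> pos B p = pos B q.
Proof.
move=> pq; apply/setP => i; rewrite !inE; case: (boolP (i \in B)) => //= iB.
by rewrite -!sgr_cp0 pq.
Qed.

Lemma eq_posP B p q : stable B -> regular_pt B p -> regular_pt B q ->
  pos B p = pos B q -> forall i, i \in B -> Num.sg (d p i) = Num.sg (d q i).
Proof.
move=> sB rp rq pq i iB.
have : (i \in pos B p) = (i \in pos B q) by rewrite pq.
rewrite !inE iB /=; have := rp _ iB; have := rq _ iB.
by case: (sgrP (d p i)); case: (sgrP (d q i)).
Qed.

Lemma eq_regular B p q :
  (forall i, i \in B -> Num.sg (d p i) = Num.sg (d q i)) ->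
  regular_pt B p -> regular_pt B q.
Proof. by move=> pq rp i iB; rewrite -sgr_eq0 -pq // sgr_eq0 rp. Qed.

(* [q] has the signs of [h + e z] for all small [e > 0]. *)
Definition after h z q := forall i,
  Num.sg (d q i) = if d h i == 0 then Num.sg (d z i) else Num.sg (d h i).

Lemma after_gt h z q i : after h z q -> 0 < d h i -> 0 < d q i.
Proof. by move=> qP hi; rewrite -sgr_cp0 qP (gt_eqF hi) gtr0_sg. Qed.

Lemma after_lt h z q i : after h z q -> d h i < 0 -> d q i < 0.
Proof. by move=> qP hi; rewrite -sgr_cp0 qP (lt_eqF hi) ltr0_sg. Qed.

Lemma after_eq h z q i : after h z q -> d h i = 0 ->
  Num.sg (d q i) = Num.sg (d z i).
Proof. by move=> qP hi; rewrite qP hi eqxx. Qed.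

Lemma after_regular B h z q : after h z q -> regular_pt B z -> regular_pt B q.
Proof.
move=> qP rz i iB; rewrite -sgr_eq0 qP; case: ifP => [_|/negbT];
  by rewrite sgr_eq0 // rz.
Qed.

Lemma after_adherent B h z q : after h z q -> adherent B q h.
Proof.
move=> qP i /posP[_ qi]; rewrite leNgt; apply/negP => /(after_lt qP).
by rewrite ltNge ltW.
Qed.

Lemma perturb_d p z : exists2 e0 : R, 0 < e0 &
  forall e, 0 < e <= e0 -> after p z (p + e *: z).
Proof.
have [e0 e0_gt0 H] := perturb dot (codom r) p z.
by exists e0 => // e ee i; apply: H => //; exact: codom_f.
Qed.

Lemma after_ex p z : exists2 e : R, 0 < e & after p z (p + e *: z).
Proof.
by have [e e0 H] := perturb_d p z; exists e => //; apply: H; rewrite e0 lexx.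
Qed.

Lemma generic_point B : exists z, regular_pt B z.
Proof.
have [z _ zP] := generic_vector dot fullv (codom r).
exists z => i _; apply: zP; first exact: codom_f.
by exists (r i); rewrite ?memvf // r_unit oner_eq0.
Qed.

Lemma regular_refine A B p : B \subset A -> regular_pt B p ->
  exists q, [/\ regular_pt A q, pos B q = pos B p &
    forall i, Num.sg (d p i) != 0 -> Num.sg (d q i) = Num.sg (d p i)].
Proof.
move=> sBA rp; have [z rz] := generic_point A.
have [e e0 /(_ e)] := perturb_d p z; rewrite e0 lexx => /(_ isT) eP.
exists (p + e *: z); split => [i iA||i].
- by rewrite -sgr_eq0 eP; case: ifP; rewrite sgr_eq0 ?rz// => ->.
- by apply: eq_pos => i iB; rewrite eP (negPf (rp _ iB)).
- by rewrite sgr_eq0 eP => /negPf->.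
Qed.

Lemma disp_flip B P a : stable B -> P \subset B ->
  (forall i, i \in B -> (neg i \in P) = (i \notin P)) ->
  a \in B -> a \notin P ->
  [\/ sigma a \in P, (sigma^-1)%g a \in P, sigma a = a | sigma a = neg a] ->
  (disp (flip a P) <= disp P)%N.
Proof.
move=> sB /subsetP sPB negP aB aP cases.
have negaP : neg a \in P by rewrite negP.
have key x y : y \in P -> sigma y \notin P ->
    [set i in flip a P | sigma i \notin flip a P] \subset
      x |: ([set i in P | sigma i \notin P] :\ y) ->
    (disp (flip a P) <= disp P)%N.
  move=> yP syP /subset_leq_card le; apply: (leq_trans le).
  rewrite cardsU1 [disp P](cardsD1 y) inE yP syP leq_add2r.
  exact: leq_b1.
have flipE i : (i \in flip a P) = (i == a) || (i != neg a) && (i \in P).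
  by rewrite !inE.
have sinj i j : (sigma i == sigma j) = (i == j) by rewrite (inj_eq perm_inj).
have [saa|saa] := eqVneq (sigma a) a.
  apply/subset_leq_card/subsetP => i; rewrite !(inE, flipE).
  have [->|ia] := eqVneq i a; first by rewrite saa eqxx.
  case/andP => /= /andP[ina iP]; rewrite iP -{1}saa sinj (negPf ia) /=.
  by rewrite -{1}saa -sigma_neg sinj ina.
have [san|san] := eqVneq (sigma a) (neg a).
  apply: (key a (neg a)) => //; first by rewrite sigma_neg san negK.
  apply/subsetP => i; rewrite !(inE, flipE).
  have [//|ia] := eqVneq i a.
  case/andP => /= /andP[ina iP]; rewrite ina iP.
  have -> : sigma i != neg a by rewrite -san sinj.
  by rewrite negb_or /= => /andP[].
have siaB : sigma a \in B by rewrite stable_sigma.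
have nsa : sigma (neg a) != a.
  by rewrite sigma_neg; apply: contraNneq san => E;
    rewrite -[X in _ == neg X]E negK.
have nsn : sigma (neg a) != neg a by rewrite sigma_neg (inj_eq (inv_inj negK)).
case: (boolP (sigma a \in P)) => [saP|saP].
  apply: (key ((sigma^-1)%g (neg a)) (neg a)) => //.
    by rewrite sigma_neg negP // saP.
  apply/subsetP => i; rewrite !(inE, flipE).
  have [->|ia] := eqVneq i a; first by rewrite (negPf saa) san saP andbF.
  case/andP => /= /andP[ina iP]; rewrite ina iP /= negb_or negb_and negbK.
  case/andP => _ /orP[/eqP sin|->]; last by rewrite orbT.
  by rewrite -sin permK eqxx.
have {cases} sVaP : (sigma^-1)%g a \in P.
  by case: cases => // E; [rewrite E in saP|rewrite E eqxx in saa
    |rewrite E eqxx in san].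
apply: (key a ((sigma^-1)%g a)) => //; first by rewrite permKV.
apply/subsetP => i; rewrite !(inE, flipE).
have [//|ia] := eqVneq i a.
case/andP => /= /andP[ina iP]; rewrite iP negb_or negb_and negbK.
case/andP => sia /orP[/eqP sin|->]; last first.
  by rewrite /= andbT; apply: contraNneq sia => ->; rewrite permKV.
have := negP _ (sPB _ sVaP).
have -> : neg ((sigma^-1)%g a) = i.
  by apply: (@perm_inj _ sigma); rewrite sigma_neg permKV -sin.
by rewrite iP sVaP.
Qed.

Lemma first_crossing B p q i0 : stable B -> i0 \in B -> d p i0 < 0 < d q i0 ->
  exists c a, [/\ 0 < c, a \in B, d p a < 0 < d q a, d (p + c *: q) a = 0 &
    forall i, i \in B -> d p i < 0 -> d (p + c *: q) i <= 0].
Proof.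
move=> sB i0B pq0.
pose F i := - d p i / d q i.
have S0 : (i0 \in B) && (d p i0 < 0 < d q i0) by rewrite i0B.
case: (arg_minP (P := fun i => (i \in B) && (d p i < 0 < d q i)) F S0).
move=> a /andP[aB /andP[pa qa]] aP.
exists (F a), a; split => //.
- by rewrite divr_gt0 ?oppr_gt0.
- by rewrite pa.
- by rewrite dD dZ /F divfK ?gt_eqF // subrr.
move=> i iB pi; rewrite dD dZ.
have Fa : 0 < F a by rewrite divr_gt0 ?oppr_gt0.
have [qi|qi] := leP (d q i) 0.
  by have := mulr_ge0_le0 (ltW Fa) qi; lra.
have := aP i; rewrite iB pi qi => /(_ isT).
by rewrite {2}/F ler_pdivlMr //; lra.
Qed.

Lemma adjacent_chamber B p q : stable B -> regular_pt B p -> regular_pt B q ->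
  pos B p <> pos B q -> exists p1 a,
  [/\ regular_pt B p1, a \in pos B q, a \notin pos B p &
      pos B p1 = flip a (pos B p)].
Proof.
move=> sB rp rq pq.
have [i0 [i0B pi0 qi0]] : exists i, [/\ i \in B, d p i < 0 & 0 < d q i].
  apply: contrapT => nex; apply: pq; apply/eqP.
  have sub i : i \in B -> d p i < 0 -> d q i < 0.
    move=> iB pi; rewrite lt_neqAle rq //= leNgt; apply/negP => qi.
    by apply: nex; exists i.
  rewrite finset.eqEsubset; apply/andP; split; apply/subsetP => i.
    case/posP => iB pi; rewrite !inE iB -oppr_lt0 -d_neg sub //.
      by rewrite stable_neg.
    by rewrite d_neg oppr_lt0.
  case/posP => iB qi; rewrite !inE iB ltNge le_eqVlt (negPf (rp _ iB)).
  by apply/negP => /(sub _ iB); rewrite ltNge ltW.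
pose b i j := d q j *: r i - d q i *: r j.
pose s := [seq b i j | i <- enum I, j <- enum I].
have [z _ zP] := generic_vector dot fullv s.
have [e1 e1gt0 eP1] := perturb dot s p z.
have [e2 e2gt0 eP2] := perturb_d p z.
pose e := Num.min e1 e2.
have e0 : 0 < e by rewrite lt_min e1gt0.
have {}eP1 := eP1 e; rewrite e0 ge_min lexx in eP1.
have {eP1} := eP1 isT => eP1.
have {}eP2 := eP2 e; rewrite e0 ge_min lexx orbT in eP2.
have {eP2} := eP2 isT => eP2.
set p' := p + e *: z in eP1 eP2.
have pp' i : i \in B -> Num.sg (d p i) = Num.sg (d p' i).
  by move=> iB; rewrite eP2 (negPf (rp _ iB)).
have rp' := eq_regular pp' rp.
have [|c [a [c0 aB /andP[pa qa] ha hP]]] := @first_crossing B p' q i0 sB i0B.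
  by rewrite qi0 andbT -sgr_cp0 -pp' // sgr_cp0.
set h := p' + c *: q in ha hP.
have only i : i \in B -> d h i = 0 -> i = a \/ i = neg a.
  move=> iB hi; apply: contrapT => nia.
  have bs : b i a \in s by apply/allpairsP; exists (i, a); rewrite !mem_enum.
  have b0 : b i a != 0.
    apply/eqP => b0; apply: nia; apply: (r_line (c := d q i / d q a)).
    apply: (scalerI (a := d q a)); first by rewrite gt_eqF.
    rewrite scalerA mulrC divfK ?gt_eqF //; apply/eqP.
    by rewrite -subr_eq0 -/(b i a) b0.
  have : dot p' (b i a) != 0.
    rewrite -sgr_eq0 eP1 //; case: ifP => [_|/negbT]; rewrite sgr_eq0 //.
    by apply: zP => //; exists (b i a); rewrite ?memvf // gt_eqF // dot_gt0.
  rewrite /b dotDr dotNr !dotZr -/(d p' i) -/(d p' a).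
  move: ha hi; rewrite /h !dD !dZ => /eqP; rewrite addr_eq0 => /eqP->.
  by move=> /eqP; rewrite addr_eq0 => /eqP->; apply/negP; rewrite negbK;
    apply/eqP; ring.
have [e3 e3gt0 /(_ e3)] := perturb_d h q; rewrite e3gt0 lexx => /(_ isT) e3P.
have pap : a \notin pos B p.
  rewrite inE aB -leNgt ltW // -sgr_cp0 pp' // sgr_cp0.
  by rewrite pa.
exists (h + e3 *: q), a; split => //.
- move=> i iB; rewrite -sgr_eq0 e3P; case: ifP => [_|/negbT]; rewrite sgr_eq0//.
  exact: rq.
- by rewrite inE aB.
apply/setP => i; rewrite !inE -sgr_cp0 e3P.
have [->|ia] := eqVneq i a; first by rewrite ha eqxx aB gtr0_sg ?eqxx.
have [->|ina] := eqVneq i (neg a).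
  rewrite !d_neg ha oppr0 eqxx sgrN gtr0_sg // ?(negPf (neg_neq a)).
  by rewrite eq_sym -subr_eq0 opprK (pnatr_eq0 _ 2) andbF.
case: (boolP (i \in B)) => //= iB.
have hi0 : d h i != 0.
  by apply/eqP => /(only _ iB)[E|E]; [rewrite E eqxx in ia|rewrite E eqxx in
    ina].
rewrite (negPf hi0) sgr_cp0 -[in RHS]sgr_cp0 pp' // sgr_cp0.
have [pi|pi|pi] := ltrgt0P (d p' i); last first.
- by have := rp' _ iB; rewrite pi eqxx.
- by apply/negbTE; rewrite -leNgt hP.
- have := hP (neg i); rewrite stable_neg // !d_neg !oppr_lte0 => /(_ iB pi).
  by rewrite le_eqVlt eq_sym (negPf hi0).
Qed.

(* The segment from [p] to [q], made generic, crosses one hyperplane at a time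
   and only hyperplanes separating [p] from [q]. *)
Lemma gallery B p q : stable B -> regular_pt B p -> regular_pt B q ->
  (forall v v' a, regular_pt B v -> regular_pt B v' ->
     pos B v' = flip a (pos B v) -> a \notin pos B v ->
     a \in pos B q -> a \notin pos B p ->
     pos B p :&: pos B q \subset pos B v ->
     (disp (pos B v') <= disp (pos B v))%N) ->
  reach B (pos B p) (pos B q).
Proof.
move=> sB rp rq; have [n] := ubnP #|pos B q :\: pos B p|.
elim: n p rp => // n IH p rp; rewrite ltnS => len H.
have [->|/eqP pq] := eqVneq (pos B p) (pos B q); first exact: connect0.
have [p1 [a [rp1 aq ap p1E]]] := adjacent_chamber sB rp rq pq.
have aB : a \in B by case/posP: aq.
apply: (@connect_trans _ _ (pos B p1)).
  apply: connect1; apply/asboolP; exists p, p1, a; split; split => //.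
    by rewrite p1E !inE eqxx.
  by apply: (H p p1 a) => //; exact: subsetIl.
have naq : neg a \notin pos B q by rewrite pos_neg // negbK.
apply: IH => //.
  apply: leq_trans len; apply: proper_card.
  apply/properP; split.
    apply/subsetP => i; rewrite p1E !in_setD => /andP[ip iq]; rewrite iq andbT.
    move: ip; rewrite !in_setU1 in_setD1 !negb_or negb_and negbK => /andP[_].
    by case/orP => // /eqP ina; rewrite ina (negPf naq) in iq.
  by exists a; rewrite in_setD ?ap ?aq // p1E in_setU1 eqxx.
have sub : pos B p :&: pos B q \subset pos B p1.
  apply/subsetP => i; rewrite p1E in_setI in_setU1 in_setD1 => /andP[ip iq].
  rewrite ip andbT; apply/orP; right.
  by apply: contraNneq naq => <-.
move=> v v' b rv rv' v'E bv bq bp1 subv; apply: (H _ _ b) => //.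
  by apply: contra bp1 => bp; apply: (subsetP sub); rewrite in_setI bp.
apply/subsetP => i ipq; apply: (subsetP subv).
by rewrite in_setI (subsetP sub _ ipq); case/setIP: ipq.
Qed.
Lemma pos_sub A B v : B \subset A -> pos B v = pos A v :&: B.
Proof.
move=> /subsetP BA; apply/setP => i; rewrite !inE;
  case: (boolP (i \in B)) => iB.
  by rewrite BA ?andbT.
by rewrite andbF.
Qed.

Lemma regular_sub A B v : B \subset A -> regular_pt A v -> regular_pt B v.
Proof. by move=> /subsetP BA rv i /BA; exact: rv. Qed.

Lemma flipE a P i : (i \in flip a P) = (i == a) || (i != neg a) && (i \in P).
Proof. by rewrite !inE. Qed.

Lemma adherent_gt A p h i : stable A -> regular_pt A p -> adherent A p h ->
  i \in A -> 0 < d h i -> i \in pos A p.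
Proof.
move=> sA rp ph iA hi; rewrite -[_ \in _]negbK -pos_neg //.
by apply/negP => /ph; rewrite d_neg oppr_ge0 leNgt hi.
Qed.

Lemma adherent_lt A p h i : adherent A p h -> d h i < 0 -> i \notin pos A p.
Proof. by move=> ph hi; apply/negP => /ph; rewrite leNgt hi. Qed.

Lemma adherent_between A p q v h : stable A ->
  regular_pt A p -> regular_pt A q -> regular_pt A v ->
  adherent A p h -> adherent A q h -> pos A p :&: pos A q \subset pos A v ->
  adherent A v h.
Proof.
move=> sA rp rq rv ph qh /subsetP sub i iv; rewrite leNgt; apply/negP => hi.
have iA : i \in A by case/posP: iv.
have : neg i \in pos A v.
  have hn : 0 < d h (neg i) by rewrite d_neg oppr_gt0.
  have nA : neg i \in A by rewrite stable_neg.
  by apply: sub; rewrite in_setI (adherent_gt sA rp ph) // (adherent_gt sA rq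
    qh).
by rewrite pos_neg // iv.
Qed.

Definition local_sub A h := [set i in A | (d h i == 0) && (d h (sigma i) == 0)].

Section Eigenvector.
Variables (A : {set I}) (h : V) (c : R).
Hypotheses (sA : stable A) (gh : g h = c *: h).
Let B := local_sub A h.

Lemma eig_sigma i : d h i = 0 -> d h ((sigma^-1)%g i) = - d h (sigma i).
Proof.
move=> hi; apply/eqP; rewrite -addr_eq0 addrC -d_g gh.
by rewrite dZ hi mulr0.
Qed.

Lemma local_subset : B \subset A.
Proof. by apply/subsetP => i; rewrite inE => /andP[]. Qed.

Lemma local_sub_stable : stable B.
Proof.
move=> i; rewrite !inE => /and3P[iA /eqP hi /eqP hsi].
rewrite stable_neg // stable_sigma // iA d_neg sigma_neg d_neg hi hsi oppr0
  eqxx.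
split => //=; have := eig_sigma hsi; rewrite permK hi => /esym/eqP.
by rewrite oppr_eq0.
Qed.

(* The hyperplanes through [h] whose image under the isometry avoids [h]
   contribute a constant: [<h, w a> = - <h, w^-1 a>] when [<h, a> = 0]. *)
Lemma disp_adherent p : regular_pt A p -> adherent A p h ->
  disp (pos A p) = (disp (pos B p) +
    (#|[set i in A | (d h i == 0%R) && (d h (sigma i) < 0)%R]| +
     #|[set i in A | (0 < d h i)%R && (d h (sigma i) < 0)%R]|))%N.
Proof.
move=> rp ph; have BA := local_subset.
have gt i := @adherent_gt A p h i sA rp ph.
have lt i := @adherent_lt A p h i ph.
have sg0 i : d h i != 0 -> 0 < d h i \/ d h i < 0.
  by rewrite neq_lt => /orP[]; [right|left].
pose D := [set i in pos A p | sigma i \notin pos A p].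
pose X := [set i | d h i == 0]; pose Y := [set i | d h (sigma i) == 0].
have DE i : (i \in D) = (i \in pos A p) && (sigma i \notin pos A p).
  exact: in_set.
have XE i : (i \in X) = (d h i == 0) by exact: in_set.
have YE i : (i \in Y) = (d h (sigma i) == 0) by exact: in_set.
rewrite {1}/disp -/D -(cardsID X D) -(cardsID Y (D :&: X)) -(cardsID Y (D :\:
  X)).
have -> : disp (pos B p) = #|D :&: X :&: Y|.
  apply: eq_card => i; rewrite !(pos_sub _ BA) !inE.
  case: (boolP (i \in A)) => //= iA; rewrite stable_sigma // iA.
  have [hi|_] := eqVneq (d h i) 0; last by rewrite !andbF.
  have [hsi|_] := eqVneq (d h (sigma i)) 0; last by rewrite !andbF.
  have : sigma i \in B by case: (local_sub_stable (i := i)) => //;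
    rewrite inE iA hi hsi eqxx.
  by rewrite inE => /and3P[_ _ ->]; rewrite !andbT.
have -> : #|[set i in A | (0 < d h i) && (d h (sigma i) < 0)]| = #|D :\: X :\:
  Y|.
  apply: eq_card => i; apply/idP/idP.
    rewrite in_set => /and3P[iA hi hsi].
    by rewrite !in_setD DE XE YE (lt_eqF hsi) (gt_eqF hi) gt // lt.
  rewrite !in_setD DE XE YE in_set => /and3P[hsi hi /andP[ip isp]].
  have iA : i \in A by case/posP: ip.
  rewrite iA /=; apply/andP; split.
    by case: (sg0 _ hi) => // /lt; rewrite ip.
  case: (sg0 _ hsi) => // hs; move: isp; rewrite gt // ?stable_sigma //.
pose N := [set i in A | (d h i == 0) && (d h (sigma i) < 0)].
rewrite -/N -(cardsID (pos A p) N).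
have NE i : (i \in N) = [&& i \in A, d h i == 0 & d h (sigma i) < 0].
  exact: in_set.
have -> : #|N :&: pos A p| = #|D :&: X :\: Y|.
  apply: eq_card => i; apply/idP/idP.
    rewrite in_setI NE => /andP[/and3P[iA hi hsi] ip].
    by rewrite in_setD in_setI DE XE YE (lt_eqF hsi) hi ip lt.
  rewrite in_setD !in_setI DE XE YE NE => /and3P[hsi /andP[ip isp] hi].
  have iA : i \in A by case/posP: ip.
  rewrite iA hi ip !andbT /=.
  by case: (sg0 _ hsi) => // hs; move: isp; rewrite gt // ?stable_sigma //.
have -> : #|N :\: pos A p| = #|(D :\: X) :&: Y|.
  rewrite -(card_imset (mem ((D :\: X) :&: Y)) (@perm_inj _ sigma)).
  apply: eq_card => j; rewrite -[j](permKV sigma); set i := (sigma^-1)%g j.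
  rewrite mem_imset; last exact: perm_inj.
  rewrite in_setD in_setI in_setD DE XE YE NE (stable_sigma _ sA).
  have [hsi|] := eqVneq (d h (sigma i)) 0; last by rewrite !(andbF, andbT).
  have hE := eig_sigma hsi; rewrite permK in hE.
  have -> : (d h (sigma (sigma i)) < 0) = (0 < d h i) by rewrite hE oppr_gt0.
  rewrite /= andbT; apply/idP/idP.
    case/and3P => isp iA hi; rewrite gt_eqF //= isp andbT.
    exact: gt.
  case/and3P => hi ip isp; have [iA _] := posP _ _ _ ip; rewrite isp iA /=.
  by case: (sg0 _ hi) => // /lt; rewrite ip.
by rewrite !addnA.
Qed.

Lemma lift_step p q : regular_pt A p -> regular_pt A q ->
  adherent A p h -> adherent A q h ->
  pos B p = pos B q \/ (exists2 a, a \in B & pos B q = flip a (pos B p)) /\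
    (disp (pos B q) <= disp (pos B p))%N ->
  reach A (pos A p) (pos A q).
Proof.
move=> rp rq ph qh pq; have BA := local_subset; have sB := local_sub_stable.
apply: gallery => // v v' a rv rv' v'E av aq ap sub.
have aA : a \in A by case/posP: aq.
have vh : adherent A v h by apply: (@adherent_between A p q).
have v'h : adherent A v' h.
  apply: (@adherent_between A p q) => //; apply/subsetP => i ipq.
  rewrite v'E flipE (subsetP sub _ ipq) andbT; apply/orP; right.
  by apply: contraTneq ipq => ->; rewrite in_setI negb_and !pos_neg // !negbK
    ?aq ?orbT.
rewrite (disp_adherent rv vh) (disp_adherent rv' v'h) leq_add2r.
have BE u : pos B u = pos A u :&: B by exact: pos_sub.
have [aB|aB] := boolP (a \in B); last first.
  suff -> : pos B v' = pos B v by [].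
  apply/setP => i; rewrite !BE v'E !in_setI flipE.
  have [iB|] := boolP (i \in B); last by rewrite !andbF.
  rewrite !andbT.
  have -> : (i == a) = false by apply: contraNF aB => /eqP<-.
  by have -> : i != neg a by apply: contraNneq aB => E;
    rewrite -(stable_neg _ sB) -E.
case: pq => [E|[[a0 a0B qE] dle]].
  have : a \in pos B p by rewrite E BE in_setI aq.
  by rewrite BE in_setI (negPf ap).
have aE : a = a0.
  have : a \in pos B q by rewrite BE in_setI aq.
  by rewrite qE flipE BE in_setI (negPf ap) andbF orbF => /eqP.
have v'BE : pos B v' = flip a (pos B v).
  apply/setP => i; rewrite !BE v'E !flipE !in_setI flipE.
  have [->|_] := eqVneq i a; first by rewrite aB.
  by rewrite andbA.
have vE : pos B v = pos B p.
  have rBv := regular_sub BA rv; have rBp := regular_sub BA rp.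
  have sub' i : i \in pos B p -> i \in pos B v.
    move=> ip; have [->|ia] := eqVneq i (neg a).
      by rewrite pos_neg // BE in_setI (negPf av).
    rewrite BE; move: (ip); rewrite {1}BE !in_setI => /andP[ipA ->];
      rewrite andbT.
    apply: (subsetP sub); rewrite in_setI ipA /=.
    have : i \in pos B q by rewrite qE flipE -aE ia ip orbT.
    by rewrite BE in_setI => /andP[].
  apply/setP => i; apply/idP/idP; last exact: sub'.
  move=> iv; have iB : i \in B by case/posP: iv.
  apply: contraLR iv => ip; rewrite -pos_neg //; apply: sub'.
  by rewrite pos_neg.
by rewrite v'BE vE aE -qE.
Qed.

Lemma lift p q : regular_pt A p -> regular_pt A q ->
  adherent A p h -> adherent A q h ->
  reach B (pos B p) (pos B q) -> reach A (pos A p) (pos A q).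
Proof.
move=> rp rq ph qh /connectP[s]; have BA := local_subset.
elim: s p rp ph => [|D s IH] p rp ph /= => [_ pq|/andP[/asboolP st sP] lst].
  by apply: lift_step => //; left.
case: st => _ [q0 [a [[_ rq0 _] [DE aD _ DflipE dle]]]].
have [q1 [rq1 q1E _]] := regular_refine BA rq0.
have [e e0 q2P] := after_ex h q1; set q2 := h + e *: q1 in q2P.
have rq2 := after_regular q2P rq1.
have q2h : adherent A q2 h := after_adherent q2P.
have q2E : pos B q2 = D.
  rewrite DE -q1E; apply: eq_pos => i; rewrite inE => /and3P[_ /eqP hi _].
  exact: (after_eq q2P).
apply: (@connect_trans _ _ (pos A q2)); last first.
  by apply: IH; rewrite ?q2E.
apply: lift_step => //; right; rewrite q2E; split => //.
by exists a => //; move: aD; rewrite DE => /posP[].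
Qed.

End Eigenvector.
Definition root_span B : {vspace V} := <<[seq r i | i <- enum B]>>%VS.

Lemma root_span_mem B i : i \in B -> r i \in root_span B.
Proof. by move=> iB; apply/memv_span/map_f; rewrite mem_enum. Qed.

Lemma root_span_orth B u v : (forall i, i \in B -> d u i = 0) ->
  v \in root_span B -> dot u v = 0.
Proof.
move=> uB; apply: span_orth => x /mapP[i]; rewrite mem_enum => iB xE;
  rewrite xE.
exact: uB.
Qed.

Lemma root_span_eq0 B v : v \in root_span B ->
  (forall i, i \in B -> d v i = 0) -> v = 0.
Proof. by move=> vB v0; apply: (@dot_eq0 _ _ dot);
  rewrite (root_span_orth v0). Qed.

Lemma root_spanS A B : B \subset A -> (root_span B <= root_span A)%VS.
Proof.
move=> /subsetP BA; apply: sub_span => x /mapP[i];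
  rewrite mem_enum => /BA iA xE.
by rewrite xE; apply: map_f; rewrite mem_enum.
Qed.

Lemma root_span_stable B v : stable B -> v \in root_span B ->
  w v \in root_span B /\ w' v \in root_span B.
Proof.
move=> sB vB.
have sub (f : 'End(V)) : (forall i, i \in B -> f (r i) \in root_span B) ->
    f v \in root_span B.
  move=> fB; have := memv_img f vB; rewrite limg_span; apply: subvP.
  apply/span_subvP => x /mapP[y /mapP[i iB yE] xE]; rewrite xE yE; apply: fB.
  by rewrite mem_enum in iB.
split; apply: sub => i iB.
  by rewrite -r_sigma root_span_mem // stable_sigma.
by rewrite -r_sigmaV root_span_mem // stable_sigmaV.
Qed.

Lemma root_span_g B v : stable B -> v \in root_span B -> g v \in root_span B.
Proof. by move=> sB /(root_span_stable sB)[? ?]; rewrite gE memvD. Qed.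

Lemma root_span_projection B v : exists2 v1, v1 \in root_span B &
  forall i, i \in B -> d v1 i = d v i.
Proof.
have [v1 v1B vP] := projection dot [seq r i | i <- enum B] v.
exists v1 => // i iB; have := vP (r i).
rewrite map_f ?mem_enum // dotDl dotNl => /(_ isT) /eqP.
by rewrite subr_eq0 eq_sym => /eqP.
Qed.

Lemma reach_chamber B P Q : reach B P Q -> P = Q \/
  exists2 q, regular_pt B q & Q = pos B q.
Proof.
move=> /connectP[s sP ->]; case/lastP: s sP => [|s P'] /=; first by left.
rewrite rcons_path last_rcons => /andP[_ /asboolP[p [q [a [[_ rq _] [-> _ _ _
  _]]]]]].
by right; exists q.
Qed.

(* A hyperplane [a^perp] crossed on the way passes through [h], and there
   [<g h, a> = <u, a> > 0]. *)
Lemma ascend B q h c k q1 (u := g h - c *: h) : stable B ->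
  regular_pt B q -> adherent B q h -> after h u k -> after k q q1 ->
  reach B (pos B q) (pos B q1).
Proof.
move=> sB rq qh hk kq1; have rq1 := after_regular kq1 rq.
apply: gallery => // v v' a rv rv' v'E av aq1 aq sub.
have [aB q1a] := posP _ _ _ aq1.
have qa : d q a < 0.
  by rewrite ltNge le_eqVlt eq_sym (negPf (rq _ aB)) /=; move: aq;
    rewrite inE aB.
have ha : d h a = 0.
  apply/eqP; rewrite eq_le; apply/andP; split.
    by rewrite -oppr_ge0 -d_neg qh // pos_neg.
  rewrite leNgt; apply/negP => /(after_lt hk) /(after_lt kq1).
  by rewrite ltNge ltW.
have ua : 0 < d u a.
  rewrite ltNge; apply/negP; rewrite le_eqVlt => /predU1P[ua|ua].
    have ka : d k a = 0.
      by apply/eqP; rewrite -sgr_eq0 (after_eq hk ha) ua sgr0.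
    move: q1a; rewrite -sgr_cp0 (after_eq kq1 ka) sgr_cp0.
    by rewrite ltNge ltW.
  have : d k a < 0 by rewrite -sgr_cp0 (after_eq hk ha) sgr_cp0.
  by move=> /(after_lt kq1); rewrite ltNge ltW.
have pv i : i \in B -> 0 < d h i -> i \in pos B v.
  move=> iB hi; apply: (subsetP sub); rewrite in_setI (adherent_gt sB rq qh)
    //=.
  by rewrite inE iB; exact: (after_gt kq1 (after_gt hk hi)).
rewrite v'E; apply: (disp_flip sB) => //.
- by apply/subsetP => i /posP[].
- by move=> i iB; rewrite pos_neg.
have : 0 < d h (sigma a) + d h ((sigma^-1)%g a).
  by move: ua; rewrite /u dD -scaleNr dZ ha mulr0 addr0 d_g.
have [hs _|hs hs'] := ltP 0 (d h (sigma a)).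
  by constructor 1; apply: pv; rewrite ?stable_sigma.
constructor 2; apply: pv; rewrite ?stable_sigmaV //; lra.
Qed.

(** * The top eigenspace *)

Section TopEigenspace.
Variables (A0 : {set I}) (mu : R).
Let U : {vspace V} := (root_span A0 :&: lker (g - mu *: \1%VF))%VS.
Hypothesis mu_max : forall v, v \in root_span A0 -> dot (g v) v <= mu * dot v v.

Lemma top_eigenP u : reflect (u \in root_span A0 /\ g u = mu *: u) (u \in U).
Proof.
rewrite memv_cap; apply: (iffP andP) => -[uA].
  rewrite memv_ker add_lfunE opp_lfunE scale_lfunE id_lfunE subr_eq0.
  by move/eqP.
move=> gu; rewrite memv_ker add_lfunE opp_lfunE scale_lfunE id_lfunE.
by rewrite gu subrr.
Qed.

(* A point of [U] with this property lies on no hyperplane of [B] other than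
   those containing [U]. *)
Definition top_regular B u := forall i, i \in B -> d u i = 0 ->
  forall z, z \in U -> d z i = 0.

Lemma top_regular_ex : exists2 z, z \in U & forall B, top_regular B z.
Proof.
have [z zU zP] := generic_vector dot U (codom r); exists z => // B i _ zi y yU.
apply: contrapT => /eqP yi; have /eqP := zi; apply/negP; apply: zP.
  exact: codom_f.
by exists y.
Qed.

Lemma reach_top B : B \subset A0 -> stable B -> forall p, regular_pt B p ->
  exists q u, [/\ regular_pt B q, reach B (pos B p) (pos B q),
    u \in U, adherent B q u & top_regular B u].
Proof.
have [n] := ubnP #|B|; elim: n B => // n IH B; rewrite ltnS => len BA0 sB p rp.
have [[i0 i0B i0U]|trivU] := pselect (exists2 i, i \in B &
    exists2 z, z \in U & d z i != 0); last first.
  exists p, 0; split; rewrite ?mem0v //; first exact: connect0.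
    by move=> i _; rewrite /d dot0l.
  move=> i iB _ z zU; apply: contrapT => /eqP zi; apply: trivU.
  by exists i => //; exists z.
pose cone (P : {set I}) := [seq r i | i <- enum P].
have [] := @rayleigh_max R V dot g (root_span B) {set I}
   (fun P => reach B (pos B p) P) cone.
  have [p1 p1B p1E] := root_span_projection B p.
  exists p1; last first.
    by apply: contra_neq (rp _ i0B); rewrite -p1E // => ->; rewrite /d dot0l.
  split => //; exists (pos B p); first exact: connect0.
  move=> x /mapP[i + xE]; rewrite mem_enum => /posP[iB pi].
  by rewrite xE -/(d p1 i) p1E ?ltW.
move=> h [[hB [P reachP hP]] h0] hmax.
have [q [rq PE]] : exists q, regular_pt B q /\ P = pos B q.
  by case: (reach_chamber reachP) => [<-|[q rq ->]]; [exists p | exists q].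
rewrite {P}PE in reachP hP.
have qh : adherent B q h.
  by move=> i iq; apply: hP; apply/map_f; rewrite mem_enum.
have {hP}hh := dot_gt0 dot h0; pose c := dot (g h) h / dot h h.
have hc : dot (g h) h = c * dot h h by rewrite /c divfK ?gt_eqF.
have kmax k q1 : k \in root_span B -> reach B (pos B q) (pos B q1) ->
    adherent B q1 k -> dot (g k) k <= c * dot k k.
  move=> kB q1P q1k; have : dot (g k) k * dot h h <= dot (g h) h * dot k k.
    apply: hmax; split => //; exists (pos B q1); first exact: connect_trans q1P.
    by move=> x /mapP[i + xE]; rewrite mem_enum xE => /q1k.
  by rewrite hc mulrAC ler_pM2r.
have gh : g h = c *: h.
  apply/eqP; rewrite -subr_eq0; apply/negPn/negP => u0.
  have [t1 t1_gt0 t1P] := critical_point g_sym hc u0.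
  have [t2 t2_gt0 t2P] := perturb_d h (g h - c *: h).
  pose t := Num.min t1 t2.
  have t_gt0 : 0 < t by rewrite lt_min t1_gt0.
  have := t2P t; rewrite t_gt0 ge_min lexx orbT => /(_ isT) {}t2P.
  have := t1P t; rewrite t_gt0 ge_min lexx => /(_ isT).
  set k := h + _ in t2P *; apply/negP; rewrite -leNgt.
  have [e _ eP] := after_ex k q.
  apply: (kmax _ (k + e *: q)).
  - by rewrite /k memvD // memvZ // memvB ?memvZ // root_span_g.
  - exact: (ascend sB rq qh t2P eP).
  - exact: after_adherent eP.
have hA0 : h \in root_span A0 by apply: (subvP (root_spanS BA0)).
have [i1 i1B i1h] : exists2 i, i \in B & d h i != 0.
  apply: contrapT => nex; move/eqP: h0; apply;
    apply: (root_span_eq0 hB) => i iB.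
  by apply: contrapT => /eqP hi; apply: nex; exists i.
pose B' := local_sub B h.
have B'B : B' \subset B := local_subset B h.
have sB' : stable B' := local_sub_stable sB gh.
have [||q' [u [rq' reachq' uU q'u ru]]] := IH B' _ _ sB' q (regular_sub B'B rq).
- apply: leq_trans len; apply: proper_card; apply/properP; split => //.
  by exists i1 => //; rewrite inE (negPf i1h) andbF.
- exact: subset_trans BA0.
have [z zU zP] := top_regular_ex.
have [e1 e1_gt0 u'P] := after_ex u z; set u' := u + e1 *: z in u'P.
have u'U : u' \in U by rewrite memvD ?memvZ.
have ru' i : i \in B -> (exists2 y, y \in U & d y i != 0) -> d u' i != 0.
  move=> iB [y yU yi]; rewrite -sgr_eq0 u'P; case: ifP => [_|/negbT];
    rewrite sgr_eq0 //.
  by apply: contra yi => /eqP /(zP _ _ iB) ->.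
have q'u' : adherent B' q' u'.
  move=> i iq'; have iB' : i \in B' by case/posP: iq'.
  have := q'u _ iq'; rewrite le_eqVlt => /predU1P[ui|/(after_gt u'P)/ltW//].
  by rewrite (ru _ iB').
have [e2 e2_gt0 kP] := after_ex h u'; set k := h + e2 *: u' in kP.
have [q2 [rq2 q2E _]] := regular_refine B'B rq'.
have [e3 e3_gt0 q3P] := after_ex k q2; set q3 := k + e3 *: q2 in q3P.
have rq3 := after_regular q3P rq2.
have q3k : adherent B q3 k := after_adherent q3P.
have q3h : adherent B q3 h.
  move=> i /posP[_ q3i]; rewrite leNgt; apply/negP => /(after_lt kP) /(after_lt
    q3P).
  by rewrite ltNge ltW.
have q3E : pos B' q3 = pos B' q'.
  rewrite -q2E; apply: eq_pos => i iB'.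
  have hi : d h i = 0 by move: iB'; rewrite inE => /and3P[_ /eqP].
  rewrite q3P; have [//|ki] := eqVneq (d k i) 0.
  rewrite (after_eq kP hi).
  have u'i : d u' i != 0 by rewrite -sgr_eq0 -(after_eq kP hi) sgr_eq0.
  have -> : Num.sg (d q2 i) = Num.sg (d q' i).
    by apply: (eq_posP sB' _ rq' q2E) => //; exact: regular_sub rq2.
  case: (ltrgt0P (d u' i)) u'i => // u'i _.
    have /posP[_ q'i] := adherent_gt sB' rq' q'u' iB' u'i.
    by rewrite !gtr0_sg.
  have := adherent_lt q'u' u'i; rewrite inE iB' -leNgt le_eqVlt (negPf (rq' _
    iB')).
  by move=> /= q'i; rewrite !ltr0_sg.
have reach3 : reach B (pos B q) (pos B q3).
  by apply: (lift sB gh) => //; rewrite q3E.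
have cmu : c <= mu by have := mu_max hA0; rewrite hc ler_pM2r.
have [cE|cne] := eqVneq c mu.
  exists q3, k; split => //; first exact: connect_trans reach3.
    by rewrite memvD ?memvZ //; apply/top_eigenP; rewrite gh cE.
  move=> i iB ki y yU; apply: contrapT => /eqP yi.
  have := ru' i iB; have := ki => /eqP; rewrite -sgr_eq0 kP.
  case: ifP => [_|/negbT]; rewrite sgr_eq0 => u'i; last by rewrite (negPf u'i).
  by rewrite u'i => /(_ (ex_intro2 _ _ y yU yi)).
have [u1 u1B u1E] := root_span_projection B u'.
have u10 : u1 != 0.
  apply: contra_neq (ru' _ i0B i0U); rewrite -u1E // => ->.
  by rewrite /d dot0l.
have dotu1 x : x \in root_span B -> dot u1 x = dot u' x.
  move=> xB; apply/eqP; rewrite -subr_eq0 -dotNl -dotDl; apply/eqP.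
  apply: root_span_orth xB => i iB.
  by rewrite dD u1E // /d dotNl subrr.
have [_ gu'] := top_eigenP _ u'U.
have gu1 : dot (g u1) u1 = mu * dot u1 u1.
  by rewrite g_sym dotu1 ?root_span_g // -g_sym gu' dotZl -dotu1.
pose k1 := h + e2 *: u1.
have : dot (g k1) k1 <= c * dot k1 k1.
  apply: (kmax _ q3) => //; first by rewrite memvD ?memvZ.
  move=> i iq3; suff -> : d k1 i = d k i by exact: q3k.
  by rewrite !dD !dZ u1E //; case/posP: iq3.
have -> : g k1 = g h + e2 *: g u1 by rewrite linearD linearZ.
rewrite gh /k1 !dotE gu1 (g_sym u1) gh dotZr (dotC dot u1 h).
have := dot_gt0 dot u10; have : c < mu by rewrite lt_neqAle cne.
set x := dot h h; set y := dot h u1; set s := dot u1 u1 => cm s0 le.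
have : 0 < e2 * e2 * (mu - c) * s by rewrite !mulr_gt0 // subr_gt0.
by move: le; lra.
Qed.

End TopEigenspace.
Lemma reach_disp B P Q : reach B P Q -> (disp Q <= disp P)%N.
Proof.
move=> /connectP[s sP ->]; elim: s P sP => //= P1 s IH P /andP[/asboolP st sP].
case: st => p [q [a [[_ _ PE] [_ _ _ _ le]]]].
exact: leq_trans (IH _ sP) le.
Qed.

Definition minimal_pt B q :=
  forall x, regular_pt B x -> (disp (pos B q) <= disp (pos B x))%N.

Lemma reach_sym B q P : stable B -> minimal_pt B q ->
  reach B (pos B q) P -> reach B P (pos B q).
Proof.
move=> sB minq /connectP[s sP ->]; elim/last_ind: s sP => [_|s Q IH].
  exact: connect0.
rewrite rcons_path last_rcons => /andP[sP st]; apply: connect_trans (IH sP).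
have le : (disp (last (pos B q) s) <= disp (pos B q))%N.
  by apply: (@reach_disp B); apply/connectP; exists s.
have /asboolP[p1 [p2 [a [[rp1 rp2 PE] [QE aQ aP QflipE dle]]]]] := st.
apply: connect1; apply/asboolP; exists p2, p1, (neg a).
have aB : a \in B by move: aQ; rewrite QE => /posP[].
split; split => //.
- by rewrite PE pos_neg // -PE.
- by rewrite QE pos_neg // -QE aQ.
- apply/setP => i; rewrite QflipE !flipE negK.
  have [->|ina] := eqVneq i (neg a); first by rewrite PE pos_neg // -PE aP.
  by have [->|ia] := eqVneq i a; rewrite ?(negPf aP).
- by apply: leq_trans le _; rewrite QE; apply: minq.
Qed.

Lemma regular_nearby h A q : regular_pt A q ->
  exists q1, [/\ regular_pt A q1, after h q q1 & adherent A q1 h].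
Proof.
move=> rq; have [e e_gt0 eP] := after_ex h q; exists (h + e *: q); split => //.
  exact: after_regular eP rq.
exact: after_adherent eP.
Qed.

Section TopPath.
Variables (A : {set I}) (mu : R) (U : {vspace V}).
Hypotheses (sA : stable A) (gU : forall u, u \in U -> g u = mu *: u).
Hypothesis wU : forall u, u \in U -> w' u \in U.

Definition containing : {set I} := [set i in A | `[< forall z, z \in U -> d z i
  = 0 >]].
Let AU := containing.

Lemma containing_sub : AU \subset A.
Proof. by apply/subsetP => i; rewrite inE => /andP[]. Qed.

Lemma containing_stable : stable AU.
Proof.
move=> i; rewrite !inE => /andP[iA /asboolP iU]; rewrite stable_neg // iA.
rewrite stable_sigma // iA; split; apply/asboolP => z zU.
  by rewrite d_neg iU // oppr0.
by rewrite /d r_sigma -w'_adj -/(d _ _) iU // wU.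
Qed.

Definition clear_of u := forall i, i \in A -> d u i = 0 -> i \in AU.

Lemma containing_eq0 u i : u \in U -> i \in AU -> d u i = 0.
Proof. by move=> uU; rewrite inE => /andP[_ /asboolP]; apply. Qed.

(* No point of the segment from [v1] to [v2] lies on both [H] and [w^-1 H],
   for a hyperplane [H] not containing [U]. *)
Definition transversal v1 v2 := forall i, i \in A -> i \notin AU ->
  d v1 i * d v2 (sigma i) - d v2 i * d v1 (sigma i) != 0.

Lemma local_sub_top h : h \in U ->
  (forall i, i \in A -> i \notin AU -> d h i = 0 -> d h (sigma i) != 0) ->
  local_sub A h = AU.
Proof.
move=> hU hP; apply/setP => i; apply/idP/idP.
  rewrite inE => /and3P[iA /eqP hi /eqP hsi]; apply/negPn/negP => ni.
  by have := hP _ iA ni hi; rewrite hsi eqxx.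
move=> iAU; rewrite inE (subsetP containing_sub) //= (containing_eq0 hU iAU).
by rewrite containing_eq0 ?stable_sigma ?eqxx //; exact: containing_stable.
Qed.

Lemma local_sub_clear h : h \in U -> clear_of h -> local_sub A h = AU.
Proof.
move=> hU hP; apply: local_sub_top => // i iA ni hi.
by have := hP i iA hi; rewrite (negPf ni).
Qed.

Lemma top_path q v1 v2 p1 p2 : regular_pt A q -> v1 \in U -> v2 \in U ->
  clear_of v1 -> clear_of v2 -> transversal v1 v2 ->
  after v1 q p1 -> after v2 q p2 -> reach A (pos A p1) (pos A p2).
Proof.
move=> rq v1U v2U + c2 + + p2P.
have sAU := containing_stable.
have [n] := ubnP #|[set i in A | d v1 i < 0 < d v2 i]|.
elim: n v1 p1 v1U => // n IH v1 p1 v1U; rewrite ltnS => len c1 tr p1P.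
have AU0 i u : u \in U -> i \in AU -> d u i = 0 by exact: containing_eq0.
have rp1 := after_regular p1P rq.
have [[i0 i0A sep]|nosep] := pselect (exists2 i, i \in A & d v1 i < 0 < d v2 i);
    last first.
  suff -> : pos A p1 = pos A p2 by exact: connect0.
  apply: eq_pos => i iA; rewrite p1P p2P.
  have [v1i|v1i] := eqVneq (d v1 i) 0.
    by rewrite (AU0 i v2) ?eqxx // c1.
  have v2i : d v2 i != 0.
    by apply: contra_neq v1i => v2i; rewrite AU0 // c2.
  rewrite (negPf v2i); apply/eqP.
  case: (ltrgt0P (d v1 i)) v1i => // v1i _;
    case: (ltrgt0P (d v2 i)) v2i => // v2i _.
  - by rewrite !gtr0_sg.
  - case: nosep; exists (neg i); rewrite ?stable_neg // !d_neg.
    by rewrite oppr_lt0 v1i oppr_gt0.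
  - by case: nosep; exists i; rewrite ?v1i.
  - by rewrite !ltr0_sg.
have [c [a [c_gt0 aA /andP[v1a v2a] ha hP]]] := first_crossing sA i0A sep.
set h := v1 + c *: v2 in ha hP.
have hU : h \in U by rewrite memvD ?memvZ.
have [e e_gt0 v3P] := after_ex h v2; set v3 := h + e *: v2 in v3P.
have v3E : v3 = v1 + (c + e) *: v2 by rewrite /v3 /h scalerDl addrA.
have v3U : v3 \in U by rewrite memvD ?memvZ.
have [p3 [rp3 p3P _]] := regular_nearby v3 rq.
have localE : local_sub A h = AU.
  apply: local_sub_top => // i iA ni; rewrite /h !dD !dZ => hi;
    apply/eqP => hsi.
  have := tr i iA ni; move/eqP: hi; rewrite addr_eq0 => /eqP->.
  move/eqP: hsi; rewrite addr_eq0 => /eqP->.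
  by apply/negP; rewrite negbK; apply/eqP; ring.
have h1 : adherent A p1 h.
  move=> i /posP[iA p1i]; have [v1i|v1i|v1i] := ltrgt0P (d v1 i).
  - have := hP (neg i); rewrite stable_neg // !d_neg oppr_lt0 oppr_le0.
    exact.
  - by move: p1i; rewrite ltNge ltW // (after_lt p1P).
  - by rewrite AU0 // c1.
have h3 : adherent A p3 h.
  move=> i /posP[_ p3i]; rewrite leNgt; apply/negP => /(after_lt v3P).
  by move=> /(after_lt p3P); rewrite ltNge ltW.
apply: (@connect_trans _ _ (pos A p3)).
  apply: (@lift A h mu) => //; first exact: gU.
  rewrite localE (_ : pos AU p1 = pos AU p3); first exact: connect0.
  by apply: eq_pos => i iAU; rewrite p1P p3P (AU0 i v1) // (AU0 i v3) // eqxx.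
have le3 i : i \in A -> d v3 i < 0 < d v2 i -> d v1 i < 0 < d v2 i.
  move=> iA /andP[v3i v2i]; rewrite v2i andbT.
  move: v3i; rewrite v3E dD dZ => v3i.
  have : 0 < (c + e) * d v2 i by rewrite mulr_gt0 // addr_gt0.
  by move: v3i; lra.
apply: (IH v3) => //.
- apply: leq_trans len; apply: proper_card; apply/properP; split.
    by apply/subsetP => i; rewrite !inE => /andP[iA /(le3 _ iA)->]; rewrite iA.
  exists a; rewrite !inE aA ?v1a //= negb_and -!leNgt.
  by rewrite v3E scalerDl addrA -/h dD ha add0r dZ mulr_ge0 // ltW.
- move=> i iA v3i; apply: c2 => //; apply/eqP; rewrite -sgr_eq0.
  have hi : d h i = 0.
    by apply/eqP/contraT => hi; have := v3P i; rewrite (negPf hi) v3i sgr0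
      => /esym/eqP; rewrite sgr_eq0 (negPf hi).
  by rewrite -(after_eq v3P hi) v3i sgr0.
- move=> i iA ni; rewrite v3E !dD !dZ.
  suff -> : forall x y z t : R, (x + (c + e) * y) * z - y * (t + (c + e) * z)
    = x * z - y * t by exact: tr.
  by move=> *; ring.
Qed.

(* Since [mu ^+ 2 < 4], [w] has no real eigenvector in [U]. *)
Lemma transversal_perturb p v1 v2 : mu ^+ 2 < 4 -> v1 \in U -> v2 \in U ->
  clear_of v1 -> clear_of v2 -> adherent A p v1 ->
  exists v, [/\ v \in U, clear_of v, adherent A p v & transversal v v2].
Proof.
move=> mu4 v1U v2U c1 c2 pv1.
pose b i := d v2 (sigma i) *: r i - d v2 i *: r (sigma i).
have dotb v i : dot v (b i) = d v i * d v2 (sigma i) - d v2 i * d v (sigma i).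
  by rewrite /b dotDr dotNr !dotZr mulrC.
have [z zU zP] := generic_vector dot U (codom b).
have [e1 e1_gt0 e1P] := perturb dot (codom b) v1 z.
have [e2 e2_gt0 e2P] := perturb_d v1 z.
pose e := Num.min e1 e2.
have e_gt0 : 0 < e by rewrite lt_min e1_gt0.
have := e1P e; rewrite e_gt0 ge_min lexx => /(_ isT) {}e1P.
have := e2P e; rewrite e_gt0 ge_min lexx orbT => /(_ isT) {}e2P.
exists (v1 + e *: z); split; first by rewrite memvD ?memvZ.
- move=> i iA vi; apply: c1 => //; apply: contrapT => /eqP v1i.
  have := e2P i; rewrite vi (negPf v1i) sgr0 => /esym/eqP.
  by rewrite sgr_eq0 (negPf v1i).
- move=> i ip; have := pv1 i ip; rewrite le_eqVlt => /predU1P[v1i|].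
    rewrite (@containing_eq0 _ i) ?memvD ?memvZ //.
    by apply: c1 => //; case/posP: ip.
  by move/(after_gt e2P)/ltW.
move=> i iA ni; rewrite -dotb -sgr_eq0 e1P ?codom_f //.
case: ifP => [_|/negbT]; rewrite sgr_eq0 //; apply: zP; first exact: codom_f.
apply: contrapT => nex.
have a0 : d v2 i != 0 by apply: contraNneq ni => /(c2 _ iA).
have eqU y : y \in U -> d v2 (sigma i) * d y i = d v2 i * d (w' y) i.
  move=> yU; have : dot y (b i) = 0.
    by apply: contrapT => /eqP yb; apply: nex; exists y.
  rewrite dotb => /eqP; rewrite subr_eq0 mulrC => /eqP ->.
  by rewrite /d r_sigma w'_adj.
have := congr1 (fun y => d y i) (congr1 w' (gU v2U)).
rewrite gE linearD linearZ /= wK dD dZ.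
have := eqU _ v2U; have := eqU _ (wU v2U).
set a := d v2 i in a0 *; set k := d v2 (sigma i).
set x := d (w' v2) i; set y := d (w' (w' v2)) i => E1 E2 E3.
have kx : x = k by apply: (mulfI a0); rewrite -E2 mulrC.
rewrite kx in E1 E3.
have : a ^+ 2 + k ^+ 2 = mu * k * a by rewrite -E3 mulrDl [y * a]mulrC -E1
  !expr2.
move=> E; have : (2 * k - mu * a) ^+ 2 = (mu ^+ 2 - 4) * a ^+ 2.
  have -> : (2 * k - mu * a) ^+ 2 =
      4 * k ^+ 2 - 4 * (mu * k * a) + mu ^+ 2 * a ^+ 2 by ring.
  by rewrite -E; ring.
have aa : 0 < a ^+ 2 by rewrite exprn_even_gt0.
have := sqr_ge0 (2 * k - mu * a) => + E'; rewrite E' leNgt => /negP; apply.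
by rewrite nmulr_rlt0 // subr_lt0.
Qed.

End TopPath.

Theorem reach_minimal A : stable A ->
  (forall v, w v = v -> forall i, i \in A -> d v i = 0) ->
  forall p q, regular_pt A p -> regular_pt A q -> minimal_pt A q ->
  reach A (pos A p) (pos A q).
Proof.
have [n] := ubnP #|A|; elim: n A => // n IH A;
  rewrite ltnS => len sA ell p q rp rq minq.
have [A0|[i0 i0A]] := set_0Vmem A.
  suff -> : pos A p = pos A q by exact: connect0.
  by apply: eq_pos => i; rewrite A0 inE.
have [] := @rayleigh_max R V dot g (root_span A) unit xpredT (fun=> [::]).
  by exists (r i0); rewrite ?r_neq0 //; split;
    [exact: root_span_mem | exists tt].
move=> h1 [[h1A _] h10] hmax.
have hh := dot_gt0 dot h10; pose mu := dot (g h1) h1 / dot h1 h1.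
have hmu : dot (g h1) h1 = mu * dot h1 h1 by rewrite /mu divfK ?gt_eqF.
have mu_max v : v \in root_span A -> dot (g v) v <= mu * dot v v.
  move=> vA; have := hmax v; rewrite hmu mulrAC ler_pM2r //; apply.
  by split => //; exists tt.
have gh1 : g h1 = mu *: h1.
  apply/eqP; rewrite -subr_eq0; apply/negPn/negP => u0.
  have [t1 t1_gt0 /(_ t1)] := critical_point g_sym hmu u0.
  rewrite t1_gt0 lexx => /(_ isT); apply/negP; rewrite -leNgt mu_max //.
  by rewrite memvD // memvZ // memvB ?memvZ // root_span_g.
have dotw v : dot (g v) v = 2 * dot (w v) v.
  by rewrite gE dotDl w'_adj (dotC dot v) mulr2n mulrDl !mul1r.
have isow v : dot (w v) (w v) = dot v v by rewrite w_adj wK.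
have [mu2|mu2] := leP mu (-2).
  have wN v : v \in root_span A -> w v = - v.
    move=> vA; apply/eqP; rewrite -addr_eq0; apply/eqP/(@dot_eq0 _ _ dot).
    rewrite !dotE isow (dotC dot v (w v)).
    have := mu_max v vA; rewrite dotw => le.
    have : mu * dot v v <= -2 * dot v v by rewrite ler_wpM2r // dot_ge0.
    lra.
  apply: gallery => // v v' a rv _ -> av aq ap _.
  have aA : a \in A by case/posP: aq.
  apply: (disp_flip sA) => //.
  - by apply/subsetP => i /posP[].
  - by move=> i iA; rewrite pos_neg.
  by constructor 4; apply: r_inj; rewrite r_sigma r_neg wN // root_span_mem.
have mu_lt2 : mu < 2.
  rewrite ltNge; apply/negP => mu_ge2; move/eqP: h10; apply.
  apply: (root_span_eq0 h1A); apply: ell; apply/eqP; rewrite -subr_eq0.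
  apply/eqP/(@dot_eq0 _ _ dot); rewrite !dotE isow (dotC dot h1 (w h1)).
  move: hmu; rewrite dotw => hmu.
  have : 2 * dot h1 h1 <= mu * dot h1 h1 by rewrite ler_wpM2r // ltW.
  lra.
pose U : {vspace V} := (root_span A :&: lker (g - mu *: \1%VF))%VS.
have UP u := @top_eigenP A mu u : reflect _ (u \in U).
have gU u : u \in U -> g u = mu *: u by move=> /UP[].
have w'U u : u \in U -> w' u \in U.
  move=> /UP[uA gu]; apply/UP; split; first by case: (root_span_stable sA uA).
  rewrite -linearZ -gu gE [in RHS]gE linearD /= wK w'K //.
have [p1 [u1 [rp1 reach1 u1U pu1 ru1]]] := reach_top mu_max (subxx _) sA rp.
have [q2 [u2 [rq2 reach2 u2U qu2 ru2]]] := reach_top mu_max (subxx _) sA rq.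
have minq2 : minimal_pt A q2.
  by move=> x rx; apply: leq_trans (minq x rx); exact: reach_disp reach2.
apply: connect_trans reach1 _; apply: connect_trans (reach_sym sA minq reach2).
pose AU := containing A U.
have clear u : top_regular A mu A u -> clear_of A U u.
  by move=> ru i iA ui; rewrite inE iA; apply/asboolP => z zU;
    exact: ru ui _ zU.
have c1 := clear _ ru1; have c2 := clear _ ru2.
have mu4 : mu ^+ 2 < 4.
  have := mulr_gt0 (_ : 0 < 2 - mu) (_ : 0 < 2 + mu); rewrite !subr_gt0.
  rewrite -[2 + mu]opprK opprD; nra.
have [v [vU cv pv tv]] := transversal_perturb gU w'U mu4 u1U u2U c1 c2 pu1.
have sAU : stable AU := containing_stable sA w'U.
have AUA : AU \subset A := containing_sub A U.
have [p3 [rp3 p3P p3v]] := regular_nearby v rq2.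
have [q3 [rq3 q3P q3u]] := regular_nearby u2 rq2.
have localE u : u \in U -> clear_of A U u -> local_sub A u = AU.
  exact: local_sub_clear.
have q3E : pos A q3 = pos A q2.
  apply: eq_pos => i iA; rewrite q3P; case: (ltrgt0P (d u2 i)) => // u2i.
    by have /posP[_ q2i] := adherent_gt sA rq2 qu2 iA u2i; rewrite !gtr0_sg.
  have := adherent_lt qu2 u2i; rewrite inE iA -leNgt le_eqVlt (negPf (rq2 _
    iA)).
  by move=> /= q2i; rewrite !ltr0_sg.
apply: (@connect_trans _ _ (pos A p3)); last first.
  by rewrite -q3E; apply: (top_path sA gU w'U rq2 vU u2U cv c2 tv p3P q3P).
apply: (lift sA (gU _ vU)) => //; rewrite localE //.
have -> : pos AU p3 = pos AU q2.
  apply: eq_pos => i iAU; rewrite p3P (_ : d v i = 0) ?eqxx //.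
  exact: containing_eq0 iAU.
have [i1 i1A i1h] : exists2 i, i \in A & d h1 i != 0.
  apply: contrapT => nex; move/eqP: h10; apply;
    apply: (root_span_eq0 h1A) => i iA.
  by apply: contrapT => /eqP hi; apply: nex; exists i.
apply: IH => //.
- apply: leq_trans len; apply: proper_card; apply/properP; split => //.
  exists i1 => //; apply: contra i1h => i1U; apply/eqP.
  by apply: containing_eq0 i1U; apply/UP.
- by move=> x wx i /(subsetP AUA); apply: ell.
- exact: regular_sub rp1.
- exact: regular_sub rq2.
move=> x rx; have [y [ry yE _]] := regular_refine AUA rx.
have [x3 [rx3 x3P x3u]] := regular_nearby u2 ry.
have x3E : pos AU x3 = pos AU x.
  rewrite -yE; apply: eq_pos => i iAU; rewrite x3P (_ : d u2 i = 0) ?eqxx //.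
  exact: containing_eq0 iAU.
have := minq2 _ rx3.
rewrite (disp_adherent sA (gU _ u2U) rq2 qu2) (disp_adherent sA (gU _ u2U) rx3
  x3u).
by rewrite localE // leq_add2r x3E.
Qed.

End Arrangement.

(** * Words and chambers of a reflection group *)

Section Length.
Variables (W : finGroupType) (S : finType) (s : S -> W).

Lemma word_prod_rcons p i : word_prod s (rcons p i) = (word_prod s p * s i)%g.
Proof. by rewrite /word_prod -cats1 big_cat big_seq1. Qed.

Lemma word_prod_cons i p : word_prod s (i :: p) = (s i * word_prod s p)%g.
Proof. by rewrite /word_prod big_cons. Qed.

Lemma has_wordP y n :
  reflect (exists2 p, size p = n & word_prod s p = y) (has_word s y n).
Proof.
apply: (iffP existsP) => [[t /eqP <-]|[p /eqP sp <-]].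
  by exists t => //; rewrite size_tuple.
by exists (Tuple sp) => /=.
Qed.

Hypothesis genW : <<[set s i | i : S]>>%g = [set: W].

Lemma ex_word y : exists p, word_prod s p = y.
Proof.
have : y \in <<[set s i | i : S]>>%g by rewrite genW inE.
case/gen_prodgP => n [f fS ->]; elim: n f fS => [|n IH] f fS.
  by exists [::]; rewrite big_ord0 /word_prod big_nil.
have [p pE] := IH (fun i => f (widen_ord (leqnSn n) i)) (fun i => fS _).
have /imsetP[i _ iE] := fS ord_max.
by exists (rcons p i); rewrite word_prod_rcons big_ord_recr /= pE iE.
Qed.

Lemma cox_lengthP y :
  (exists2 p, size p = cox_length s y & word_prod s p = y) /\
  forall p, word_prod s p = y -> (cox_length s y <= size p)%N.
Proof.
rewrite /cox_length; case: pselect => [ex|nex]; last first.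
  by have [p pE] := ex_word y; case: nex; exists (size p); apply/has_wordP;
    exists p.
case: ex_minnP => m /has_wordP[p sp pE] mP; split; first by exists p.
by move=> p' p'E; apply: mP; apply/has_wordP; exists p'.
Qed.

End Length.

Section Twisted.
Variables (W : finGroupType) (delta : {perm W}).
Variable autd : delta \in Aut [set: W]%SET.
Local Notation tin := (tw_in autd).

Lemma tw_inM a b : tin (a * b)%g = (tin a * tin b)%g.
Proof. by rewrite /tw_in morphM. Qed.

Lemma tw_in1 : tin 1%g = 1%g.
Proof. exact: morph1. Qed.

Lemma tw_inV a : tin a^-1%g = ((tin a)^-1)%g.
Proof. by rewrite /tw_in morphV. Qed.

Lemma tw_in_inj : injective tin.
Proof. by move=> a b; apply: (injmP (injm_sdpair1 _)); rewrite inE. Qed.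

Lemma tw_in_conj (x : twisted autd) a : exists b, (x * tin a * x^-1)%g = tin b.
Proof.
have /sdprod_context[/andP[_ nW] _ _ _ _] :=
  sdprod_sdpair (aut_groupAction [set: W]%SET \ cycle_sub_Aut autd)%gact.
have : (tin a ^ (x^-1))%g \in
    (sdpair1 (aut_groupAction [set: W]%SET \ cycle_sub_Aut autd)%gact @* [set:
      W]%SET)%g.
  rewrite memJ_norm; first by rewrite mem_morphim ?inE.
  exact: (fintype.subsetP nW _ (finset.in_setT _)).
by case/morphimP => b _ _ bE; exists b; rewrite -[RHS]bE conjgE invgK mulgA.
Qed.

Lemma tw_decomp (x : twisted autd) :
  exists n, x = (tw_delta autd ^+ n * tin x.2)%g.
Proof.
have xD : x.1 \in <[delta]>%g by case: (x) => -[a b] /= /setXP[].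
have : x.1 \in <[delta^-1]>%g by rewrite cycleV.
case/cycleP => n xE; exists n; rewrite {1}[x]sdpairE xE /tw_delta morphX //.
by rewrite groupV cycle_id.
Qed.

End Twisted.

Section WeylGroup.
Import mathcomp.boot.fintype mathcomp.boot.finset.
Local Open Scope group_scope.
Variables (W : finGroupType) (S : finType) (s : S -> W).
Variable delta : {perm W}.
Variable autd : delta \in Aut [set: W].
Local Notation TW := (twisted autd).
Local Notation tin := (tw_in autd).
Variables (R : realType) (V : normedVectType R) (dot : {dot V for idfun}).
Variable rho : TW -> 'End(V).
Hypothesis reprho : orth_faithful_rep dot rho.
Variables (I : finType) (r : I -> V) (neg : I -> I) (refl : I -> W).
Hypothesis r_neg : forall i, r (neg i) = (- r i)%R.
Hypothesis r_unit : forall i, dot (r i) (r i) = 1%R.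
Hypothesis r_line : forall i j (c : R), (r i = c *: r j)%R -> i = j \/ i = neg
  j.
Hypothesis reflE : forall i v,
  (rho (tin (refl i)) v = v - (2 * dot v (r i)) *: r i)%R.
Hypothesis refl_all : forall t, is_reflection dot (rho (tin t)) ->
  exists i, refl i = t.
Implicit Types (x y : TW) (a b i j : I) (u v q : V).

Local Notation d v i := (dot v (r i)).
Local Notation regular_pt v := (regular_pt dot r [set: I] v).
Local Notation pos v := (pos dot r [set: I] v).
Local Notation flip := (flip neg).

Lemma rho1 v : rho 1 v = v.
Proof. by case: reprho => -> _ _ _; rewrite id_lfunE. Qed.

Lemma rhoM x y v : rho (x * y) v = rho x (rho y v).
Proof. by case: reprho => _ -> _ _; rewrite comp_lfunE. Qed.

Lemma rho_iso x u v : dot (rho x u) (rho x v) = dot u v.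
Proof. by case: reprho. Qed.

Lemma rhoK x : cancel (rho x) (rho x^-1).
Proof. by move=> v; rewrite -rhoM mulVg rho1. Qed.

Lemma rhoVK x : cancel (rho x^-1) (rho x).
Proof. by move=> v; rewrite -rhoM mulgV rho1. Qed.

Lemma rho_adj x u v : dot (rho x u) v = dot u (rho x^-1 v).
Proof. by rewrite -(rho_iso x u) rhoVK. Qed.

Lemma rho_ext x y : (forall v, rho x v = rho y v) -> x = y.
Proof. by case: reprho => _ _ inj _ xy; apply: inj; apply/lfunP. Qed.

Let r_injective : injective r := r_inj r_neg r_unit r_line.

Lemma refl_conj x i t : x * tin (refl i) * x^-1 = tin t ->
  forall v, (rho (tin t) v = v - (2 * dot v (rho x (r i))) *: rho x (r i))%R.
Proof.
move=> <- v; rewrite !rhoM reflE linearB linearZ /= rhoVK.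
by rewrite rho_adj invgK.
Qed.

Lemma act_ex x i : exists j, r j = rho x (r i).
Proof.
have [t tE] := tw_in_conj x (refl i); have xt := refl_conj tE.
have ux : dot (rho x (r i)) (rho x (r i)) = 1%R by rewrite rho_iso.
have [j jt] : exists j, refl j = t.
  apply: refl_all; exists (rho x (r i)).
    by apply: contra_eq_neq ux => ->; rewrite dot0l eq_sym oner_eq0.
  by move=> v; rewrite xt ux divr1.
have := xt (rho x (r i)); rewrite -jt reflE ux mulr1 => /addrI/oppr_inj E.
have {}E : rho x (r i) = (dot (rho x (r i)) (r j) *: r j)%R.
  by apply: (scalerI (a := 2%R)); rewrite ?pnatr_eq0 // scalerA -E.
set c := dot _ _ in E; have c1 : (c ^+ 2 = 1)%R.
  by rewrite -[RHS]ux [in RHS]E !dotE r_unit mulr1 expr2.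
have /eqP := c1; rewrite sqrf_eq1 => /orP[]/eqP cE.
  by exists j; rewrite E cE scale1r.
by exists (neg j); rewrite r_neg E cE scaleN1r.
Qed.

Definition act x i : I := odflt i [pick j | r j == rho x (r i)].

Lemma actE x i : r (act x i) = rho x (r i).
Proof.
rewrite /act; case: pickP => [j /eqP //|nE].
by have [j jE] := act_ex x i; have := nE j; rewrite jE eqxx.
Qed.

Lemma actM x y i : act (x * y) i = act x (act y i).
Proof. by apply: r_injective; rewrite !actE rhoM. Qed.

Lemma act1 i : act 1 i = i.
Proof. by apply: r_injective; rewrite actE rho1. Qed.

Lemma actK x : cancel (act x) (act x^-1).
Proof. by move=> i; rewrite -actM mulVg act1. Qed.

Lemma actVK x : cancel (act x^-1) (act x).
Proof. by move=> i; rewrite -actM mulgV act1. Qed.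

Lemma act_neg x i : act x (neg i) = neg (act x i).
Proof. by apply: r_injective; rewrite actE !r_neg actE linearN. Qed.

Lemma refl_act w i : refl (act (tin w) i) = w * refl i * w^-1.
Proof.
apply: (@tw_in_inj _ _ autd); apply: rho_ext => v.
rewrite (@refl_conj (tin w) i (w * refl i * w^-1));
  last by rewrite !tw_inM tw_inV.
by rewrite reflE actE.
Qed.

Lemma mem_pos v i : (i \in pos v) = (0 < d v i)%R.
Proof. by rewrite inE inE. Qed.

Lemma pos_act x v i : (act x i \in pos (rho x v)) = (i \in pos v).
Proof. by rewrite !mem_pos actE rho_iso. Qed.

Lemma mem_pos_rho x v i : (i \in pos (rho x v)) = (act x^-1 i \in pos v).
Proof. by rewrite -{1}(actVK x i) pos_act. Qed.

Lemma pos_flip x u v a : pos u = flip a (pos v) ->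
  pos (rho x u) = flip (act x a) (pos (rho x v)).
Proof.
move=> uv; apply/setP => i; rewrite -(actVK x i) pos_act uv !flipE pos_act.
by rewrite -act_neg !(can_eq (actK x)).
Qed.

Lemma regular_rho x v : regular_pt v -> regular_pt (rho x v).
Proof.
by move=> rv i _; rewrite -(actVK x i) actE rho_iso; apply: rv; rewrite inE.
Qed.

Lemma stableT (sigma : {perm I}) : stable neg sigma [set: I].
Proof. by move=> i _; rewrite !inE. Qed.

Lemma pos_negT v i : regular_pt v -> (neg i \in pos v) = (i \notin pos v).
Proof.
by move=> rv; apply: (pos_neg r_neg r_unit r_line (stableT 1)) => //;
  rewrite inE.
Qed.

Section Chamber.
Local Open Scope classical_set_scope.
Local Open Scope ring_scope.
Hypothesis normV : forall v : V, dot v v = `|v| ^+ 2.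
Variables (c : V).
Hypothesis rc : regular_pt c.
Let C : set V := connected_component (Defs.regular dot rho) c.
Hypothesis wallsC :
  walls dot rho C = [set fixed_by rho (tin (s k)) | k in [set: S]].

Hypothesis reflS : forall k, is_reflection dot (rho (tin (s k))).

Lemma fixedE i v : fixed_by rho (tin (refl i)) v <-> d v i = 0.
Proof.
rewrite /fixed_by /= reflE; split => [/eqP|->];
  last by rewrite mulr0 scale0r subr0.
rewrite -subr_eq0 addrAC subrr add0r oppr_eq0 scaler_eq0 mulf_eq0 pnatr_eq0 /=.
by case/orP => [/eqP//|/eqP r0]; have := r_unit i;
  rewrite r0 dot0l => /esym/eqP;
  rewrite oner_eq0.
Qed.

Lemma refl_is_reflection i : is_reflection dot (rho (tin (refl i))).
Proof.
exists (r i); first by apply: contra_eq_neq (r_unit i) => ->;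
  rewrite dot0l eq_sym oner_eq0.
by move=> v; rewrite reflE r_unit divr1.
Qed.

Lemma regularE v : Defs.regular dot rho v <-> regular_pt v.
Proof.
split => [rv i _|rv [_ [t /refl_all[i <-] <-]]].
  apply/eqP => vi; apply: rv; exists (fixed_by rho (tin (refl i))).
    by exists (refl i) => //; exact: refl_is_reflection.
  exact/fixedE.
by move/fixedE => /eqP; apply/negP/rv; rewrite inE.
Qed.

Lemma d_norm v i : `|d v i| <= `|v|.
Proof.
have : 0 <= dot (v - d v i *: r i) (v - d v i *: r i) by exact: dot_ge0.
have -> : dot (v - d v i *: r i) (v - d v i *: r i) = `|v| ^+ 2 - d v i ^+ 2.
  by rewrite !dotE r_unit (dotC dot (r i)) normV; ring.
rewrite subr_ge0.
have -> : d v i ^+ 2 = `|d v i| ^+ 2 by rewrite real_normK ?num_real.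
by rewrite ler_sqr // nnegrE.
Qed.

Lemma d_sub u v i : d u i - d v i = d (u - v) i.
Proof. by rewrite !dotE. Qed.

Lemma d_continuous i : continuous (fun v => d v i).
Proof.
move=> v; apply/cvgrPdist_le => e e0; apply/nbhs_normP; exists e => // u /= vu.
by rewrite d_sub (le_trans (d_norm _ _)) // ltW.
Qed.

Lemma chamber_cell v : C v <-> regular_pt v /\ pos v = pos c.
Proof.
split => [Cv|[rv vc]].
  have rv : regular_pt v by apply/regularE; exact: connected_component_sub Cv.
  split => //; apply/setP => i; case: Cv => B [Bc BA Bco] Bv.
  have itv : is_interval ((fun v => d v i) @` B).
    apply/connected_intervalP/connected_continuous_connected => //.
    exact/continuous_subspaceT/d_continuous.
  have no0 : ~ ((fun v => d v i) @` B) 0.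
    by case=> u /BA/regularE/(_ i (in_setT i))/eqP.
  have mem u : B u -> ((fun v => d v i) @` B) (d u i) by move=> Bu; exists u.
  rewrite !mem_pos; apply/idP/idP => pi; rewrite ltNge; apply/negP => qi;
    apply: no0.
    by apply: (itv _ _ (mem _ Bc) (mem _ Bv)); rewrite qi ltW.
  by apply: (itv _ _ (mem _ Bv) (mem _ Bc)); rewrite qi ltW.
pose f (t : R) : V := c + t *: (v - c).
have fE t i : d (f t) i = (1 - t) * d c i + t * d v i.
  by rewrite /f dotDl dotZl -d_sub; ring.
have cf : continuous f.
  move=> t; apply: (@continuousD _ _ _ (fun=> c) (fun t : R => t *: (v - c))).
    exact: cst_continuous.
  exact: scalel_continuous.
apply: (@connected_component_max _ _ (f @` `[0, 1]) c).
- by exists 0; rewrite /f ?scale0r ?addr0 //= in_itv /= lexx ler01.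
- move=> _ [t /= + <-]; rewrite in_itv /= => /andP[t0 t1];
    apply/regularE => i _.
  rewrite fE; have := eq_posP (stableT 1) rv rc vc (in_setT i).
  have [ci|ci|ci] := ltrgt0P (d c i).
  + rewrite (gtr0_sg ci) => /eqP; rewrite sgr_cp0 => vi; apply: lt0r_neq0.
    by move: t0; rewrite le_eqVlt => /predU1P[<-|t0]; nra.
  + rewrite (ltr0_sg ci) => /eqP; rewrite sgr_cp0 => vi; apply: ltr0_neq0.
    by move: t0; rewrite le_eqVlt => /predU1P[<-|t0]; nra.
  by have := rc (in_setT i); rewrite ci eqxx.
- apply: connected_continuous_connected; first exact: segment_connected.
  exact: continuous_subspaceT.
by exists 1; rewrite /f ?scale1r ?subrKC //= in_itv /= lexx ler01.
Qed.

Lemma chamber_closure u i : closure C u -> i \in pos c -> 0 <= d u i.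
Proof.
move=> Cu ic; have : closed [set v | 0 <= d v i].
  apply: (@closed_comp _ _ (fun v => d v i) [set x | 0 <= x]).
    by move=> x _; exact: d_continuous.
  exact: closed_ge.
move/closure_id => E; suff : [set v | 0 <= d v i] u by [].
rewrite E; apply: closureS Cu => v /chamber_cell[_ vc] /=.
by move: ic; rewrite -vc mem_pos => /ltW.
Qed.

Lemma independent a b : b <> a -> b <> neg a ->
  exists2 u, d u a = 0 & d u b != 0.
Proof.
move=> ba bna; exists (r b - d (r b) a *: r a).
  by rewrite dotDl dotNl dotZl r_unit mulr1 subrr.
apply/eqP => E; suff : b = a \/ b = neg a by case.
  apply: (r_line (c := d (r b) a)); apply/eqP; rewrite -subr_eq0; apply/eqP.
  apply: (@dot_eq0 _ _ dot); rewrite dotDr E add0r -scaleNr dotZr dotDl.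
  by rewrite dotZl r_unit mulr1 subrr mulr0.
Qed.

Definition wall_pt a h := d h a = 0 /\
  forall b, b \in pos c -> b != neg a -> 0 < d h b.

Lemma refl_neg a : refl (neg a) = refl a.
Proof.
apply: (@tw_in_inj _ _ autd); apply: rho_ext => v.
by rewrite !reflE r_neg dotNr mulrN scaleNr scalerN opprK.
Qed.

Lemma wall_pt_sg a h i : a \notin pos c -> wall_pt a h -> d h i != 0 ->
  Num.sg (d h i) = Num.sg (d c i).
Proof.
move=> ac [ha hP] hi.
have [ci|ci] := boolP (i \in pos c).
  have [ina|ina] := eqVneq i (neg a).
    by move: hi; rewrite ina r_neg dotNr ha oppr0 eqxx.
  by rewrite (gtr0_sg (hP _ ci ina)) gtr0_sg // -mem_pos.
have [ia|ia] := eqVneq i a; first by rewrite ia ha eqxx in hi.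
have nic : neg i \in pos c by rewrite pos_negT.
have nia : neg i != neg a.
  by rewrite (inj_eq (inv_inj (negK r_neg r_unit r_line))).
have := hP _ nic nia; move: nic; rewrite mem_pos r_neg !dotNr !oppr_gt0.
by move=> c0 h0; rewrite !ltr0_sg.
Qed.

Lemma wall_flip a h : a \notin pos c -> wall_pt a h ->
  pos (rho (tin (refl a)) c) = flip a (pos c).
Proof.
move=> ac wh; have [ha hP] := wh; set t := tin (refl a).
have th : rho t h = h by exact/fixedE.
have ta i : d (rho t c) i = d c i - 2 * d c a * dot (r a) (r i).
  by rewrite reflE !dotE.
have [e1 e1_gt0 e1P] := perturb_d dot r h c.
have [e2 e2_gt0 e2P] := perturb_d dot r h (rho t c).
pose e := Num.min e1 e2.
have e_gt0 : 0 < e by rewrite lt_min e1_gt0.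
have := e1P e; rewrite e_gt0 ge_min lexx => /(_ isT) {}e1P.
have := e2P e; rewrite e_gt0 ge_min lexx orbT => /(_ isT) {}e2P.
have E1 : pos (h + e *: c) = pos c.
  apply: eq_pos => i _; rewrite e1P; case: eqP => // /eqP.
  exact: wall_pt_sg wh.
have E2 : pos (rho t c) = pos (h + e *: rho t c).
  rewrite -{1}th -linearZ -linearD; apply/setP => i.
  by rewrite !(mem_pos_rho t) E1.
rewrite E2; apply/setP => i; rewrite flipE !mem_pos -!sgr_cp0 e2P.
have ca : d c a < 0.
  by rewrite lt_neqAle rc ?inE //= leNgt -mem_pos.
have [->|ia] := eqVneq i a.
  by rewrite ha eqxx ta r_unit mulr1 !sgr_cp0 /=; lra.
have [->|ina] := eqVneq i (neg a).
  rewrite r_neg !dotNr ha oppr0 eqxx ta r_unit mulr1 !sgr_cp0 /=.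
  by apply/negbTE; rewrite -leNgt; lra.
have [hi|hi] := eqVneq (d h i) 0; last by rewrite (wall_pt_sg ac wh) // sgr_cp0.
have [ic|ic] := boolP (i \in pos c).
  by have := hP _ ic ina; rewrite hi ltxx.
have nic : neg i \in pos c by rewrite pos_negT.
have := hP _ nic; rewrite (inj_eq (inv_inj (negK r_neg r_unit r_line))) => /(_
  ia).
by rewrite r_neg dotNr hi oppr0 ltxx.
Qed.

Lemma simple_wall k :
  exists a h, [/\ refl a = s k, a \notin pos c & wall_pt a h].
Proof.
have [a0 a0E] := refl_all (reflS k).
have [a [aE ac]] : exists a, refl a = s k /\ a \notin pos c.
  have [a0c|] := boolP (a0 \in pos c); last by exists a0.
  by exists (neg a0); rewrite refl_neg pos_negT // negbK.
have : walls dot rho C (fixed_by rho (tin (s k))) by rewrite wallsC; exists k.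
case=> _ [v]; rewrite -aE => /fixedE va /nbhs_normP[e0 /= e0_gt0 near].
pose U := lker (rho (tin (refl a)) - \1%VF).
have UP u : reflect (d u a = 0) (u \in U).
  rewrite memv_ker add_lfunE opp_lfunE id_lfunE subr_eq0.
  by apply: (iffP eqP) => /fixedE.
have [z zU zP] := generic_vector dot U (codom r).
have [e1 e1_gt0 e1P] := perturb_d dot r v z.
pose e := Num.min e1 (e0 / (`|z| + 1)).
have z1 : 0 < `|z| + 1 by rewrite ltr_wpDl.
have e_gt0 : 0 < e by rewrite lt_min e1_gt0 divr_gt0.
have := e1P e; rewrite e_gt0 ge_min lexx => /(_ isT) {}e1P.
have va' : d (v + e *: z) a = 0 by rewrite dotDl dotZl va (UP _ zU) mulr0 addr0.
exists a, (v + e *: z); split => //; split => // b bc bna.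
have : closure C (v + e *: z).
  apply: near; last exact/fixedE.
  rewrite /= opprD addNKr normrN normrZ gtr0_norm //.
  apply: (@lt_le_trans _ _ (e * (`|z| + 1))).
    by rewrite ltr_pM2l // ltrDl.
  by rewrite -ler_pdivlMr // ge_min lexx orbT.
move/chamber_closure => /(_ b bc); rewrite le_eqVlt => /predU1P[b0|//].
have ba : b <> a by move=> ba; rewrite ba (negPf ac) in bc.
have zb : d z b != 0.
  apply: zP; first exact: codom_f.
  have [u ua ub] := independent ba (elimN eqP bna).
  by exists u => //; exact/UP.
have := e1P b; rewrite -b0 sgr0; case: ifP => [_|/negbT vb] /esym/eqP;
  by rewrite sgr_eq0 ?(negPf zb) ?(negPf vb).
Qed.

Lemma adjacent_wall q a : regular_pt q -> a \notin pos c ->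
  pos q = flip a (pos c) -> exists k, refl a = s k /\ exists h, wall_pt a h.
Proof.
move=> rq ac qE.
have ca : d c a < 0 by rewrite lt_neqAle rc ?inE //= leNgt -mem_pos.
have qa : 0 < d q a by rewrite -mem_pos qE flipE eqxx.
pose h := c + (- d c a / d q a) *: q.
have wh : wall_pt a h.
  split; first by rewrite /h dotDl dotZl divfK ?gt_eqF // subrr.
  move=> b bc bna; rewrite /h dotDl dotZl addr_gt0 -?mem_pos //.
  rewrite mulr_gt0 ?divr_gt0 ?oppr_gt0 //.
  by rewrite -mem_pos qE flipE bna bc orbT.
have [ha hP] := wh.
have [e0 e0_gt0 e0P] : exists2 e0, 0 < e0 &
    forall b, b \in pos c -> b != neg a -> e0 <= d h b.
  case: (pickP (fun b => (b \in pos c) && (b != neg a))) => [b0 b0P|none];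
    last first.
    by exists 1 => // b bc bna; have := none b; rewrite bc bna.
  case: (arg_minP (P := fun b => (b \in pos c) && (b != neg a)) (fun b => d h
    b) b0P) => b /andP[bc bna] bP.
  by exists (d h b); [exact: hP | move=> b' b'c b'na; apply: bP; rewrite b'c].
have : walls dot rho C (fixed_by rho (tin (refl a))).
  split; first by exists (refl a) => //; exact: refl_is_reflection.
  exists h; first exact/fixedE.
  apply/nbhs_normP; exists e0 => // u /= hu /fixedE ua B /nbhs_normP[e e_gt0
    eB].
  pose y := e / (`|c| + 1); have c1 : 0 < `|c| + 1 by rewrite ltr_wpDl.
  have y_gt0 : 0 < y by rewrite divr_gt0.
  have sub i : i \in pos c -> 0 < d (u + y *: c) i.
    move=> ic; have ci : 0 < d c i by rewrite -mem_pos.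
    have yci : 0 < y * d c i by rewrite mulr_gt0.
    rewrite dotDl dotZl; have [ina|ina] := eqVneq i (neg a).
      by rewrite {1}ina r_neg dotNr ua oppr0 add0r.
    have := le_lt_trans (d_norm (h - u) i) hu; rewrite -d_sub => /ltr_normlW.
    by have := e0P _ ic ina; lra.
  exists (u + y *: c); split.
    apply/chamber_cell.
    have sub' i : i \notin pos c -> d (u + y *: c) i < 0.
      by rewrite -pos_negT // => /sub; rewrite r_neg dotNr oppr_gt0.
    split => [i _|].
      have [/sub/lt0r_neq0//|/sub'/ltr0_neq0//] := boolP (i \in pos c).
    apply/setP => i; rewrite mem_pos; have [/sub//|/sub' lt0] := boolP (i \in
      pos c).
    by apply/negbTE; rewrite -leNgt ltW.
  apply: eB => /=; rewrite opprD addNKr normrN normrZ gtr0_norm //.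
  by rewrite /y mulrAC ltr_pdivrMr // ltr_pM2l // ltrDl.
rewrite wallsC => -[k _ kE]; exists k; split; last by exists h.
have [a' a'E] := refl_all (reflS k); rewrite -a'E.
have [->//|/eqP ne] := eqVneq a a'.
have [->|/eqP nne] := eqVneq a (neg a'); first by rewrite refl_neg.
have [u ua /eqP []] := independent ne nne.
by apply/fixedE; rewrite -kE -a'E; apply/fixedE.
Qed.

End Chamber.

Variable c : V.
Hypothesis rc : regular_pt c.
Hypothesis simple_flip : forall k : S, exists a,
  [/\ refl a = s k, a \notin pos c & pos (rho (tin (s k)) c) = flip a (pos c)].
Hypothesis adjacent_simple : forall q a, regular_pt q -> a \notin pos c ->
  pos q = flip a (pos c) -> exists k, pos q = pos (rho (tin (s k)) c).
Hypothesis delta_stable : pos (rho (tw_delta autd) c) = pos c.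
Hypothesis genW : <<[set s k | k : S]>> = [set: W].
Hypothesis s2 : forall k, s k * s k = 1.

Local Notation P y := (pos (rho (tin y) c)).
Definition sep_number x := #|pos c :\: pos (rho x c)|.

Lemma regular_chamber x : regular_pt (rho x c).
Proof. exact: regular_rho. Qed.

Lemma P_step (y : W) k : exists a, [/\ refl a = y * s k * y^-1, a \notin P y &
  P (y * s k) = flip a (P y)].
Proof.
have [a [ra ac aE]] := simple_flip k; exists (act (tin y) a).
by rewrite refl_act ra pos_act tw_inM rhoM (pos_flip _ aE).
Qed.

Lemma sep_step (y : W) k a : a \notin P y -> P (y * s k) = flip a (P y) ->
  if a \in pos c then sep_number (tin y) = (sep_number (tin (y * s k))).+1
  else sep_number (tin (y * s k)) = (sep_number (tin y)).+1.
Proof.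
move=> aP E; rewrite /sep_number E.
have naP : neg a \in P y by rewrite (pos_negT _ (@regular_chamber _)).
have [ac|ac] := boolP (a \in pos c).
  have nac : neg a \notin pos c by rewrite pos_negT // negbK.
  rewrite [LHS](cardsD1 a) in_setD aP ac add1n; congr _.+1; apply: eq_card => i.
  rewrite in_setD1 !in_setD flipE.
  have [->|ia] := eqVneq i a; first by [].
  have [->|//] := eqVneq i (neg a); first by rewrite (negPf nac) !andbF.
have nac : neg a \in pos c by rewrite pos_negT.
rewrite [LHS](cardsD1 (neg a)) in_setD flipE eqxx /= nac orbF.
rewrite (neg_neq r_neg r_unit) add1n; congr _.+1; apply: eq_card => i.
rewrite in_setD1 !in_setD flipE.
have [->|ina] := eqVneq i (neg a); first by rewrite naP.
have [->|//] := eqVneq i a; first by rewrite (negPf ac) !andbF.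
Qed.

(* The gallery of [p] from [c] must cross the hyperplane of [b]; deleting the
   corresponding letter multiplies the product by the reflection in [b]. *)
Lemma exchange p b : b \in pos c -> b \notin P (word_prod s p) ->
  exists2 p', (size p').+1 = size p & word_prod s p' = refl b * word_prod s p.
Proof.
move=> bc; elim/last_ind: p => [|p k IH].
  by rewrite /word_prod big_nil tw_in1 rho1 bc.
rewrite word_prod_rcons; have [a [ra aP E]] := P_step (word_prod s p) k.
have [bp|bp] := boolP (b \in P (word_prod s p)); last first.
  have [p' sp' p'E] := IH bp => _; exists (rcons p' k);
    first by rewrite !size_rcons sp'.
  by rewrite word_prod_rcons p'E mulgA.
rewrite E flipE bp andbT negb_or negbK => /andP[_ /eqP bE].
exists p; first by rewrite size_rcons.
by rewrite bE refl_neg ra mulgA mulgKV -mulgA s2 mulg1.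
Qed.

Lemma reduced_sep p :
  (forall p', word_prod s p' = word_prod s p -> (size p <= size p')%N) ->
  sep_number (tin (word_prod s p)) = size p.
Proof.
elim/last_ind: p => [|p k IH] minp.
  by rewrite /sep_number /word_prod big_nil tw_in1 rho1 setDv cards0.
have {}IH : sep_number (tin (word_prod s p)) = size p.
  apply: IH => p' p'E; have := minp (rcons p' k).
  by rewrite !word_prod_rcons p'E !size_rcons ltnS; apply.
rewrite word_prod_rcons size_rcons.
have [a [ra aP E]] := P_step (word_prod s p) k.
have := sep_step aP E; case: ifP => [ac _|_ ->]; last by rewrite IH.
have [p' sp' p'E] := exchange ac aP.
have := minp p'; rewrite size_rcons -sp' word_prod_rcons p'E ra mulgKV.
by move=> /(_ erefl); rewrite ltnNge leqnSn.
Qed.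

Lemma cox_length_sep (y : W) : cox_length s y = sep_number (tin y).
Proof.
have [[p sp pE] minp] := cox_lengthP genW y.
by rewrite -pE reduced_sep pE // => p' /minp; rewrite sp.
Qed.

Lemma tw_length_sep x : tw_length s x = sep_number x.
Proof.
rewrite /tw_length cox_length_sep; have [n xE] := tw_decomp x.
set y := tin _ in xE *; rewrite /sep_number xE rhoM.
elim: n {xE} => [|n IH]; first by rewrite expg0 rho1.
rewrite IH expgS rhoM -[in RHS]delta_stable.
set z := tw_delta autd; set u := rho _ (rho _ _).
rewrite -(card_imset _ (can_inj (actK z))); apply: eq_card => i.
rewrite -(actVK z i) mem_imset ?in_setD ?pos_act //; exact: can_inj (actK z).
Qed.

Lemma sep_chamber x y :
  #|[set i in pos (rho y c) | act x^-1 i \notin pos (rho y c)]| =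
  sep_number (y^-1 * x * y).
Proof.
rewrite /sep_number -[RHS](card_imset _ (can_inj (actK y)));
  apply: eq_card => i.
rewrite -(actVK y i) mem_imset; last exact: can_inj (actK y).
set j := act y^-1 i; rewrite in_setD andbC.
have -> : (j \in pos (rho (y^-1 * x * y) c)) =
    (act x^-1 (act y j) \in pos (rho y c)).
  by rewrite mem_pos_rho (mem_pos_rho y) !invMg invgK !actM.
by rewrite -(pos_act y); exact: in_set.
Qed.

Lemma act_inj x : injective (act x).
Proof. exact: can_inj (actK x). Qed.

Lemma chamber_simple v (y : W) a : regular_pt v -> a \notin P y ->
  pos v = flip a (P y) -> exists k, pos v = P (y * s k).
Proof.
move=> rv aP E; have [||k kE] := @adjacent_simple (rho (tin y)^-1 v) (act (tin
  y)^-1 a)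
    (regular_rho _ rv).
- by rewrite -(pos_act (tin y)) actVK.
- by rewrite (pos_flip _ E) -!rhoM mulVg rho1.
exists k; apply/setP => i.
rewrite tw_inM rhoM (mem_pos_rho (tin y)) -kE -[in RHS](pos_act (tin y)).
by rewrite actVK rhoVK.
Qed.

Lemma chamber_transitive v : regular_pt v -> exists y : W, pos v = P y.
Proof.
move=> rv; have [n] := ubnP #|pos v :\: P (1 : W)|; move: (1 : W) => y.
elim: n y => // n IH y; rewrite ltnS => len.
have [<-|/eqP ne] := eqVneq (P y) (pos v); first by exists y.
have ry := @regular_chamber (tin y).
have [v1 [a [rv1 av ay E]]] :=
  adjacent_chamber r_neg r_unit r_line (stableT 1) ry rv ne.
have [k kE] := chamber_simple rv1 ay E.
apply: (IH (y * s k)); apply: leq_trans len; apply: proper_card.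
have nav : neg a \notin pos v by rewrite pos_negT // negbK.
apply/properP; rewrite -kE E; split.
  apply/subsetP => i; rewrite !in_setD flipE negb_or negb_and negbK.
  case/andP => /andP[_ /orP[/eqP->|->//]] iv; by rewrite (negPf nav) in iv.
by exists a; rewrite !in_setD ?ay // flipE eqxx.
Qed.

Lemma chamber_free (y z : W) : P y = P z -> y = z.
Proof.
move=> yz; have E : P (z^-1 * y) = P 1.
  apply/setP => i; rewrite tw_inM rhoM tw_in1 rho1 mem_pos_rho yz.
  by rewrite -mem_pos_rho -rhoM -tw_inM mulVg tw_in1 rho1.
have len0 : cox_length s (z^-1 * y) = 0%N.
  by rewrite cox_length_sep /sep_number E tw_in1 rho1 setDv cards0.
have [[p sp pE] _] := cox_lengthP genW (z^-1 * y).
move: sp pE; rewrite len0 => /size0nil -> /esym.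
rewrite /word_prod big_nil => /(congr1 (mulg z)).
by rewrite mulKVg mulg1.
Qed.

Lemma tw_inV_simple k : (tin (s k))^-1 = tin (s k).
Proof. by apply/eqP; rewrite eq_invg_mul -tw_inM s2 tw_in1. Qed.

Lemma conj_path_end x p y : conj_path s x p y ->
  y = (tin (word_prod s p))^-1 * x * tin (word_prod s p).
Proof.
elim: p x => [|k p IH] x /=.
  by move=> /eqP->; rewrite /word_prod big_nil tw_in1 invg1 mul1g mulg1.
case/andP => _ /IH ->; rewrite word_prod_cons !tw_inM invMg.
by rewrite tw_inV_simple !mulgA.
Qed.

Theorem conj_path_surj (O : {set TW}) x : O \in classes [set: TW] ->
  x \in class_min s O ->
  (forall v, rho x v = v -> forall i, d v i = 0%R) ->
  forall z : W, tin z * x = x * tin z ->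
  exists2 p, conj_path s x p x & word_prod s p = z.
Proof.
move=> classO minx ell z zx.
have [xO /forall_inP minO] : x \in O /\ [forall y in O, (tw_length s x <=
  tw_length s y)%N].
  by move: minx; rewrite inE => /andP[].
have OE : O = x ^: [set: TW].
  by have /imsetP[x0 _ E] := classO; rewrite E in xO *; apply/esym/class_eqP.
have sigma_inj : injective (act x^-1) by exact: act_inj.
pose sigma := perm sigma_inj.
have r_sigma i : r (sigma i) = rho x^-1 (r i) by rewrite permE actE.
have w_adj u v : dot (rho x^-1 u) v = dot u (rho x v) by rewrite rho_adj invgK.
have dispE (y : W) :
    disp sigma (P y) = tw_length s ((tin y)^-1 * x * tin y).
  rewrite tw_length_sep -sep_chamber; apply: eq_card => i.
  apply: etrans (in_set _ _) _; apply/esym; apply: etrans (in_set _ _) _.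
  by rewrite permE.
have zfix : (tin z)^-1 * x * tin z = x by rewrite -mulgA -zx mulKg.
have : reach dot r neg sigma [set: I] (P 1) (P z).
  apply: (reach_minimal w_adj (rhoVK x) (rhoK x) r_neg r_sigma r_unit r_line)
    => //.
  - by move=> v vx i _; apply: ell; rewrite -{1}vx rhoVK.
  - exact: regular_chamber.
  - exact: regular_chamber.
  move=> v /chamber_transitive[y ->]; rewrite !dispE zfix minO // OE.
  by apply/imsetP; exists (tin y); rewrite ?inE // conjgE mulgA.
have walk (q : seq {set I}) : forall y : W, path (step dot r neg sigma [set:
  I]) (P y) q ->
    P z = last (P y) q ->
    exists2 p, conj_path s ((tin y)^-1 * x * tin y) p x & y * word_prod s p = z.
  elim: q => [|D q IH] y /=.
    move=> _ /chamber_free <-; exists [::]; first by rewrite /= zfix.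
    by rewrite /word_prod big_nil mulg1.
  case/andP => /asboolP[_ [v [a [[_ rv _] [DE _ aP Dflip le]]]]] qP lst.
  have [k kE] : exists k, pos v = P (y * s k).
    by apply: (chamber_simple rv aP); rewrite -DE.
  rewrite DE kE in le qP lst; have [p pP pE] := IH _ qP lst.
  exists (k :: p); last by rewrite word_prod_cons mulgA.
  have xE : tin (s k) * ((tin y)^-1 * x * tin y) * tin (s k) =
      (tin (y * s k))^-1 * x * tin (y * s k).
    by rewrite !tw_inM invMg tw_inV_simple !mulgA.
  by rewrite /= xE pP andbT -!dispE.
case/connectP => q qP lst; have [p pP pE] := walk _ _ qP lst.
by exists p; [move: pP; rewrite tw_in1 invg1 mul1g mulg1 | rewrite -pE mul1g].
Qed.

End WeylGroup.

Section Roots.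
Variables (W : finGroupType) (delta : {perm W}).
Variable autd : delta \in Aut [set: W]%SET.
Local Notation TW := (twisted autd).
Local Notation tin := (tw_in autd).
Variables (R : realType) (V : normedVectType R) (dot : {dot V for idfun}).
Variable rho : TW -> 'End(V).
Hypothesis reprho : orth_faithful_rep dot rho.

Lemma unit_normal (f : V -> V) : is_reflection dot f ->
  exists a, dot a a = 1 /\ forall v, f v = v - (2 * dot v a) *: a.
Proof.
case=> a a0 fE; have aa := dot_gt0 dot a0.
pose k := Num.sqrt (dot a a); have k0 : 0 < k by rewrite sqrtr_gt0.
have kk : dot a a = k ^+ 2 by rewrite sqr_sqrtr // ltW.
exists (k^-1 *: a); split.
  by rewrite !dotE kk; field; exact: lt0r_neq0.
move=> v; rewrite fE kk dotZr scalerA; congr (_ - _ *: _).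
by field; exact: lt0r_neq0.
Qed.

Lemma root_system_ex : exists (I : finType) (r : I -> V) (neg : I -> I)
    (refl : I -> W),
  [/\ forall i, r (neg i) = - r i, forall i, dot (r i) (r i) = 1,
      forall i j (c : R), r i = c *: r j -> i = j \/ i = neg j,
      forall i v, rho (tin (refl i)) v = v - (2 * dot v (r i)) *: r i
    & forall t, is_reflection dot (rho (tin t)) -> exists i, refl i = t].
Proof.
pose T := {t : W | `[< is_reflection dot (rho (tin t)) >]}.
have [t|a aP] := @choice T V (fun t a => dot a a = 1 /\
    forall v, rho (tin (val t)) v = v - (2 * dot v a) *: a).
  exact/unit_normal/asboolP/(valP t).
pose r (i : T * bool) : V := (-1) ^+ i.2 *: a i.1.
exists (T * bool)%type, r, (fun i => (i.1, ~~ i.2)), (fun i => val i.1).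
have sq (b : bool) : (-1) ^+ b * (-1) ^+ b = 1 :> R by rewrite -expr2 sqrr_sign.
have rr i : dot (r i) (r i) = 1.
  by rewrite /r dotZl dotZr mulrA sq mul1r; case: (aP i.1).
have rE i v : rho (tin (val i.1)) v = v - (2 * dot v (r i)) *: r i.
  have [_ ->] := aP i.1; rewrite /r dotZr scalerA; congr (_ - _ *: _).
  by rewrite -mulrA mulrAC sq mul1r.
split => //.
- by move=> [t b]; rewrite /r /= signrN scaleNr.
- move=> [t b] [t' b'] c E.
  have c2 : c * c = 1 by have := rr (t, b); rewrite E dotZl dotZr rr mulr1.
  have tt' : t = t'.
    apply/val_inj/(@tw_in_inj _ _ autd); case: reprho => _ _ inj _; apply: inj.
    apply/lfunP => v; rewrite (rE (t, b)) (rE (t', b')) E dotZr scalerA.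
    by congr (_ - _ *: _); rewrite -mulrA mulrAC c2 mul1r.
  by rewrite tt'; case: b b' {E} => -[]; [left|right|right|left].
move=> t tP; have tT : `[< is_reflection dot (rho (tin t)) >] by apply/asboolP.
by exists (Sub t tT, false).
Qed.

End Roots.

Local Open Scope classical_set_scope.

Theorem corollary4p4 (W : finGroupType) (S : finType) (s : S -> W)
    (coxW : coxeter_system s)
    (delta : {perm W}) (autd : delta \in Aut [set: W]%SET)
    (permd : (delta @: [set s i | i : S] = [set s i | i : S])%SET)
    (R : realType) (V : normedVectType R) (dot : {dot V for idfun})
    (normV : forall v : V, dot v v = `|v| ^+ 2)
    (rho : twisted autd -> 'End(V))
    (reprho : orth_faithful_rep dot rho)
    (reflS : forall i, is_reflection dot (rho (tw_in autd (s i))))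
    (C : set V) (chamC : fundamental_chamber s dot rho C)
    (O : {set twisted autd}) (classO : O \in classes [set: twisted autd]%SET)
    (ellO : elliptic rho O)
    (x : twisted autd) (minx : x \in class_min s O) :
  set_fun (loops s x) (centW x) (word_prod s) /\
  set_surj (loops s x) (centW x) (word_prod s).
Proof.
have [I [r [neg [refl [r_neg r_unit r_line reflE refl_all]]]]] :=
  root_system_ex reprho.
case: coxW => m [m1 _ _] [genW relW _].
have s2 k : (s k * s k = 1)%g by have := relW k k; rewrite m1 expg1.
have [[c /(regularE r_unit reflE refl_all) rc CE] wallsC deltaC] := chamC.
rewrite CE in wallsC deltaC.
have simple_flip k : exists a, [/\ refl a = s k, a \notin pos dot r [set:
  I]%SET c &
    pos dot r [set: I]%SET (rho (tw_in autd (s k)) c) =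
    flip neg a (pos dot r [set: I]%SET c)].
  have [a [h [aE ac wh]]] :=
    simple_wall reprho r_neg r_unit r_line reflE refl_all normV rc wallsC reflS
      k.
  exists a; split => //; rewrite -aE.
  exact: (wall_flip reprho r_neg r_unit r_line reflE refl_all rc ac wh).
have adjacent_simple q a : regular_pt dot r [set: I]%SET q ->
    a \notin pos dot r [set: I]%SET c ->
    pos dot r [set: I]%SET q = flip neg a (pos dot r [set: I]%SET c) ->
    exists k, pos dot r [set: I]%SET q =
      pos dot r [set: I]%SET (rho (tw_in autd (s k)) c).
  move=> rq ac qE.
  have [k [kE [h wh]]] :=
    adjacent_wall reprho r_neg r_unit r_line reflE refl_all normV rc wallsC
      reflS rq ac qE.
  by exists k; rewrite -kE (wall_flip reprho r_neg r_unit r_line reflE refl_all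
    rc ac wh).
have delta_stable : pos dot r [set: I]%SET (rho (tw_delta autd) c) =
    pos dot r [set: I]%SET c.
  have Cc : connected_component (Defs.regular dot rho) c c.
    exact/(chamber_cell neg r_unit reflE refl_all normV rc).
  have : (rho (tw_delta autd) @` connected_component (Defs.regular dot rho) c)
    (rho (tw_delta autd) c) by exists c.
  by rewrite deltaC => /(chamber_cell neg r_unit reflE refl_all normV rc)[].
have ell v : rho x v = v -> forall i, dot v (r i) = 0.
  case: ellO => x0 x0O fix0 vx i.
  have /imsetP[y _ xE] : x \in (x0 ^: [set: twisted autd]%SET)%g.
    have /imsetP[y0 _ OE] := classO; rewrite OE in x0O.
    by rewrite (class_eqP x0O) -OE; move: minx; rewrite inE => /andP[].
  have fixy : fixed_by rho x0 (rho y v).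
    rewrite /fixed_by /= -(rhoM reprho) -{2}vx -(rhoM reprho) xE conjgE.
    by rewrite !mulgA mulgV mul1g.
  have := fix0 _ fixy (refl (act rho r y i)) Logic.I.
  move/(fixedE r_unit reflE).
  by rewrite (actE reprho r_neg r_unit reflE refl_all) (rho_iso reprho).
split.
  move=> p /(conj_path_end s2) E; rewrite /centW /= {1}E.
  by rewrite -!mulgA mulKVg.
move=> z zx; have [p pP pE] := conj_path_surj reprho r_neg r_unit r_line reflE
  refl_all
  rc simple_flip adjacent_simple delta_stable genW s2 classO minx ell zx.
by exists p.
Qed.
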